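(* Let $\mathcal{H}$ be a toric hyperplane arrangement on the torus $T^n=\mathbb{R}^n/\mathbb{Z}^n$ that subdivides the torus into open $n$-dimensional balls, and let $\mathcal{P}$ be its intersection poset. Then the number of regions of the complement of $\mathcal{H}$ equals $Z_t(\mathcal{P})$.
   Context: A toric hyperplane is the image under $\mathbb{R}^n\to\mathbb{R}^n/\mathbb{Z}^n$ of a hyperplane $\{\vec x:\vec a\cdot\vec x=b\}$ with $\vec a\in\mathbb{Q}^n\setminus\{0\}$, $b\in\mathbb{R}$; a toric arrangement is a finite collection $\{H_1,\dots,H_m\}$ of them. The intersection poset $\mathcal{P}$ consists of all connected components of all intersections $\bigcap_{i\in S}H_i$ (the empty intersection being $T^n$), together with $\emptyset$, ordered by reverse inclusion; its minimum $\hat0$ is $T^n$ and maximum $\hat1$ is $\emptyset$. Ranks: $\rho(x)=n-\dim x$ for nonempty $x$, and $\rho(\emptyset)=n+1$. For such a poset, $Z_t(\mathcal{P})=\sum_{x}(-1)^{\rho(x)}\mu(\hat0,x)$, the sum over all coatoms $x$ of $\mathcal{P}$ (elements covered by $\hat1$), where $\mu$ is the Möbius function. *)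

(* Defs.v *)
From HB Require Import structures.
From mathcomp Require Import all_boot all_order all_algebra finmap.
From mathcomp Require Import generic_quotient.
From mathcomp Require Import all_classical all_reals all_analysis.

Set Implicit Arguments.
Unset Strict Implicit.
Unset Printing Implicit Defensive.

Import Order.TTheory GRing.Theory Num.Theory.
Import numFieldNormedType.Exports.

Local Open Scope classical_set_scope.
Local Open Scope ring_scope.

Section FinitePoset.
Context {d : Order.disp_t} {U : porderType d} (P : {fset U}).
Implicit Types x y z : U.

(* A chain in P has at most #|` P | elements, so #|` P | steps of the
   recursion reach its fixed point: see [mobiusE]. *)
Fixpoint mobius_rec (k : nat) (x y : U) : int :=
  if x == y then 1 else
  if k is k'.+1 then
    - \sum_(z <- P | ((x <= z) && (z < y))%O) mobius_rec k' x z
  else 0.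

Definition mobius : U -> U -> int := mobius_rec #|` P |.

Definition covered_in (x y : U) : bool :=
  [&& x \in P, y \in P, (x < y)%O &
      all (fun z => ~~ ((x < z) && (z < y))%O) (enum_fset P)].

Let below (y : U) : nat := #|` [fset z in P | (z < y)%O]%fset |.

Let below_lt z y : z \in P -> (z < y)%O -> (below z < below y)%N.
Proof.
move=> zP zy; apply: fproper_ltn_card; rewrite fproperE.
apply/andP; split; [apply/fsubsetP => w | apply/negP => /fsubsetP/(_ z)].
  by rewrite !inE /= => /andP[-> wz]; exact: lt_trans wz zy.
by rewrite !inE /= zP zy ltxx => /(_ isT).
Qed.

Let mobius_rec_stable k k' x y :
  (below y < k)%N -> (below y < k')%N -> mobius_rec k x y = mobius_rec k' x y.
Proof.
elim: k k' y => // k IH [//|k'] y yk yk' /=.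
case: ifP => // _; apply: congr1.
rewrite big_seq_cond [RHS]big_seq_cond; apply: eq_bigr => z.
move=> /andP[zP /andP[_ zy]]; have lt := below_lt zP zy.
by apply: IH; apply: leq_trans lt _.
Qed.

Let below_max y : y \in P -> (below y < #|` P |)%N.
Proof.
move=> yP; apply: fproper_ltn_card; rewrite fproperE.
apply/andP; split; [apply/fsubsetP => w | apply/negP => /fsubsetP/(_ y yP)].
  by rewrite !inE /= => /andP[].
by rewrite !inE /= ltxx andbF.
Qed.

Lemma mobiusE x y : y \in P ->
  mobius x y = if x == y then 1
               else - \sum_(z <- P | ((x <= z) && (z < y))%O) mobius x z.
Proof.
move=> yP; rewrite /mobius.
rewrite -(@mobius_rec_stable #|` P |.+1 #|` P | x y) /=; last exact: below_max.
  by case: eqP => //.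
by rewrite ltnS ltnW // below_max.
Qed.

Lemma mobius_refl x : mobius x x = 1.
Proof. by rewrite /mobius; case: #|` P | => [|k] /=; rewrite eqxx. Qed.

Lemma mobius_sum x y : y \in P -> (x < y)%O ->
  \sum_(z <- P | ((x <= z) && (z <= y))%O) mobius x z = 0.
Proof.
move=> yP xy; rewrite big_mkcond (bigD1_seq y) ?fset_uniq //=.
rewrite lexx ltW //= -big_mkcondr (mobiusE x yP) lt_eqF // addrC.
apply/eqP; rewrite subr_eq0; apply/eqP; apply: eq_bigl => z.
by rewrite lt_neqAle andbCA.
Qed.

End FinitePoset.

Section Torus.
Context (R : realType) (n : nat).

Definition lattice_equiv (x y : 'rV[R]_n) : bool :=
  [forall i, x ord0 i - y ord0 i \is a Num.int].

Lemma lattice_equiv_refl : reflexive lattice_equiv.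
Proof. by move=> x; apply/forallP => i; rewrite subrr rpred0. Qed.

Lemma lattice_equiv_sym : symmetric lattice_equiv.
Proof.
by move=> x y; apply: eq_forallb => i; rewrite -opprB rpredN.
Qed.

Lemma lattice_equiv_trans : transitive lattice_equiv.
Proof.
move=> y x z /forallP xy /forallP yz; apply/forallP => i.
by rewrite -(subrKA (y ord0 i)) rpredD.
Qed.

Canonical lattice_equivRel :=
  EquivRel lattice_equiv lattice_equiv_refl lattice_equiv_sym
           lattice_equiv_trans.

Definition torus := quotient_topology {eq_quot lattice_equivRel}%qT.
HB.instance Definition _ := Topological.on torus.
HB.instance Definition _ := Quotient.on torus.

Definition torus_proj (x : 'rV[R]_n) : torus := (\pi_torus x)%qT.

Definition toric_hyperplane (X : set torus) : Prop :=
  exists (a : 'rV[rat]_n) (b : R), a != 0 /\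
    X = torus_proj @`
          [set x : 'rV[R]_n | \sum_(i < n) ratr (a ord0 i) * x ord0 i = b].

Definition component_of (A X : set torus) : Prop :=
  exists2 x, A x & X = connected_component A x.

Definition open_unit_ball : set 'rV[R]_n :=
  [set x | \sum_(i < n) x ord0 i ^+ 2 < 1].

Definition open_cell (X : set torus) : Prop :=
  exists (f : torus -> 'rV[R]_n) (g : 'rV[R]_n -> torus),
    [/\ {within X, continuous f}, {within open_unit_ball, continuous g},
        f @` X `<=` open_unit_ball, g @` open_unit_ball `<=` X &
        {in X, cancel f g} /\ {in open_unit_ball, cancel g f}].

(* X is the image of a k-dimensional affine subspace of R^n.  Such a k is
   unique: if p + V + Z^n = q + W + Z^n then V is covered by countably many
   translates of W, whence V is included in W, and conversely. *)
Definition has_toric_dim (X : set torus) (k : nat) : Prop :=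
  exists (p : 'rV[R]_n) (V : 'M[R]_(k, n)), row_free V /\
    X = torus_proj @` [set x | exists u : 'rV[R]_k, x = p + u *m V].

(* Only meaningful when X is a nonempty toric subspace. *)
Definition toric_dim (X : set torus) : nat := xget 0%N (has_toric_dim X).

Definition toric_rank (X : set torus) : nat :=
  if X == set0 then n.+1 else (n - toric_dim X)%N.

Section Arrangement.
Context (m : nat) (H : 'I_m -> set torus).

Definition regions : set (set torus) :=
  [set X | component_of (~` \bigcup_i H i) X].

Definition flats : set (set torus) :=
  [set X | X = set0 \/
     exists S : {set 'I_m}, component_of (\bigcap_(i in [set` S]) H i) X].

(* [flats] is finite when every H i is a toric hyperplane, and then
   [fset_set flats] has the same elements. *)
Definition intersection_poset : {fset (set torus)^d} := fset_set flats.

Definition Zt : int :=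
  \sum_(X <- intersection_poset | covered_in intersection_poset X set0)
     (-1) ^+ toric_rank X * mobius intersection_poset setT X.

End Arrangement.
End Torus.

(* Main.v *)
(** Normalise each hyperplane to the image of [{x | l x - b \in Z}] with [l] a
    primitive integral form.  Lifted to [R^n], the faces of the arrangement are
    cut out by fixing, for every form, either its integral value or the open
    unit interval containing it.

    If the normals did not span, some nonzero integral vector [v] would be
    orthogonal to all of them, and the closed loop [x + t v] would lie in a
    region; the region being a ball, the loop would be contractible, which a
    winding number computed on a fine grid forbids.  So the normals span, and
    the coatoms of the poset are the zero-dimensional flats.

    For a flat [Y], let [E(Y)] be the sum of [(-1)^codim F] over the faces [F]
    contained in [Y].  Removing a hyperplane does not change [E(Y)] as long as
    the remaining normals span, because the faces merged into one bounded face
    are slices of it alternating between open slabs and walls, starting and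
    ending with slabs.  Once the arrangement is minimal, either [Y] is a point
    and [E(Y) = (-1)^n], or some hyperplane is independent of the others and
    exchanging its walls with the adjacent slabs shows that [E(Y) = 0].

    Finally the sum of [mu(0, Y)] over the flats [Y] containing a face [F] is
    [1] if [F] is a region and [0] otherwise, so the number of regions is the
    sum of [mu(0, Y) E(Y)] over all flats. *)

From mathcomp Require Import all_boot all_order all_algebra finmap.
From mathcomp Require Import all_classical all_reals all_analysis.
From mathcomp Require Import zify ring lra.
Require Import Defs.

Set Implicit Arguments.
Unset Strict Implicit.
Unset Printing Implicit Defensive.

Import Order.TTheory GRing.Theory Num.Theory.
Import numFieldNormedType.Exports.

Local Open Scope classical_set_scope.
Local Open Scope ring_scope.

(** * Topological and combinatorial preliminaries *)

Lemma connected_component_relopen {T : topologicalType} {J : Type}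
    (A : set T) (D : set J) (B U : J -> set T) :
  A `<=` \bigcup_(i in D) B i ->
  (forall i, D i -> [/\ connected (B i), open (U i) & A `&` U i = B i]) ->
  (forall i j, D i -> D j -> B i `&` B j !=set0 -> B i = B j) ->
  forall i x, D i -> B i x -> connected_component A x = B i.
Proof.
move=> Acover Bpieces Bmeet i x Di Bix.
have BA j : D j -> B j `<=` A by case/Bpieces => _ _ <- ? [].
have [conn_Bi open_Ui trace_Ui] := Bpieces i Di.
apply/seteqP; split; last exact: connected_component_max (BA i Di) conn_Bi.
set C := connected_component A x.
have CA : C `<=` A by exact: connected_component_sub.
suff <- : C `&` B i = C by move=> ? [].
apply: (component_connected (A := A) (x := x)).
- by exists x; split=> //; apply: connected_component_refl; exact: BA Bix.
- exists (U i) => //; rewrite -trace_Ui setIA.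
  by congr (_ `&` _); apply/setIidl.
- exists (~` \bigcup_(j in [set j | D j /\ B j <> B i]) U j).
    by apply: open_closedC; apply: bigcup_open => j [/Bpieces[]].
  apply/seteqP; split=> p [Cp Bp]; split=> //.
    move=> [j [Dj neq_ji] Ujp]; apply: neq_ji; apply: Bmeet => //.
    exists p; split=> //; have [_ _ <-] := Bpieces j Dj.
    by split=> //; exact: CA.
  have [j Dj Bjp] := Acover p (CA p Cp).
  apply: contrapT => Bip; apply: Bp; exists j.
    by split=> // eq_ji; rewrite eq_ji in Bjp.
  by move: Bjp; have [_ _ <-] := Bpieces j Dj => -[].
Qed.

Lemma star_shaped_connected {R : realType} {V : normedModType R} (B : set V)
    (x : V) :
  B x -> (forall w (t : R), B w -> 0 <= t <= 1 -> B (x + t *: (w - x))) ->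
  connected B.
Proof.
move=> Bx Bstar.
pose seg w : set V := (fun t : R => x + t *: (w - x)) @` `[0, 1].
have -> : B = \bigcup_(w in B) seg w.
  apply/seteqP; split=> [w Bw|_ [w Bw [t t01 <-]]].
    exists w => //; exists 1; last by rewrite scale1r addrC subrK.
    by rewrite /= in_itv /= ler01 lexx.
  by apply: Bstar => //; rewrite /= in_itv in t01.
apply: bigcup_connected => [|w _].
  exists x => w _; exists 0; last by rewrite scale0r addr0.
  by rewrite /= in_itv /= ler01 lexx.
apply: connected_continuous_connected; first exact: segment_connected.
apply: continuous_subspaceT => t; apply: cvgD; first exact: cvg_cst.
by apply: cvgZr_tmp; exact: cvg_id.
Qed.

Lemma compact_near_diagonal {R : realType} {M : pseudoMetricType R}
    (K : set M) (P : M -> M -> Prop) :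
  compact K ->
  (forall u, K u -> \forall u' \near u & u'' \near u, P u' u'') ->
  \forall e \near 0^'+, forall u, K u -> forall u', ball u e u' -> P u u'.
Proof.
move=> /compact_near_coveringP covK Pnear.
apply: (covK R 0^'+ (fun e u => forall u', ball u e u' -> P u u')) => u Ku.
have [[A B] /= [nA nB] ABP] := Pnear u Ku.
have [e /= e0 ballAB] := (nbhs_ballP u _).1 (filterI nA nB).
exists (ball u (e / 2), [set d | d < e / 2]) => /=.
  split; first by apply: nbhsx_ballx; rewrite divr_gt0.
  by apply: nbhs_right_lt; rewrite divr_gt0.
move=> [u' d] /= [uu' de] u'' u'u''.
have e2 : e / 2 <= e by lra.
apply: (ABP (u', u'')); split=> /=.
  by have [] := ballAB u' (le_ball e2 uu').
have [] // := ballAB u''; rewrite [e]splitr; apply: ball_triangle uu' _.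
exact: le_ball (ltW de) _ u'u''.
Qed.

Lemma int_set_interval (K : set int) (M : int) :
  K !=set0 -> (forall c, K c -> `|c| <= M) ->
  (forall c1 c c2, K c1 -> K c2 -> c1 <= c <= c2 -> K c) ->
  exists a e, [/\ K a, K e & forall c, K c <-> a <= c <= e].
Proof.
move=> [c0 Kc0] KM Kconv.
have lbK : lbound K (- M) by move=> c /KM; lia.
have [a [Ka aK]] := int_lbound_has_minimum (ex_intro _ c0 Kc0) lbK.
have lbKN : lbound (-%R @` K) (- M) by move=> _ [c /KM cM <-]; lia.
have KN0 : -%R @` K !=set0 by exists (- c0), c0.
have [_ [[e Ke <-] eK]] := int_lbound_has_minimum KN0 lbKN.
exists a, e; split=> // c; split=> [Kc|]; last exact: Kconv.
by rewrite aK //=; have := eK (- c) (imageP _ Kc); lia.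
Qed.

Lemma sumr_sign (V : pzRingType) n :
  \sum_(0 <= k < n) (-1) ^+ k = (odd n)%:R :> V.
Proof.
elim: n => [|n IHn]; first by rewrite big_geq.
rewrite big_nat_recr //= IHn -signr_odd.
by case: (odd n); rewrite ?subrr ?add0r.
Qed.

Lemma sumr_sign_reversing (T : eqType) (V : numDomainType) (s : seq T)
    (P : pred T) (f : T -> V) (tau : T -> T) :
  uniq s -> {in s, forall x, tau x \in s} -> {in s, cancel tau tau} ->
  {in s, forall x, P (tau x) = P x} -> {in s, forall x, f (tau x) = - f x} ->
  \sum_(x <- s | P x) f x = 0.
Proof.
move=> us tau_s tauK Ptau ftau; set S := \sum_(x <- s | P x) f x.
have perm_tau : perm_eq s (map tau s).
  apply: uniq_perm => // [|x].
    by rewrite map_inj_in_uniq //; exact: can_in_inj tauK.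
  apply/idP/mapP => [xs|[y ys ->]]; last exact: tau_s.
  by exists (tau x); rewrite ?tauK ?tau_s.
have : S = - S.
  rewrite {1}/S (perm_big _ perm_tau) big_map /= big_seq_cond.
  rewrite (eq_bigl (fun x => (x \in s) && P x)) => [|x]; last first.
    by case: (boolP (x \in s)) => //= /Ptau.
  rewrite (eq_bigr (fun x => - f x)) => [|x /andP[/ftau]//].
  by rewrite sumrN -big_seq_cond.
by move/eqP; rewrite -subr_eq0 opprK -mulr2n mulrn_eq0 => /eqP.
Qed.

Lemma sumr_refine (T : eqType) (V : nmodType) (r s : seq T)
    (P Q : pred T) (below : rel T) (f : T -> V) :
  uniq r ->
  {in s, forall y, exists2 x0, x0 \in r &
    {in r, forall x, below y x = (x == x0)} /\ P x0 = Q y} ->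
  \sum_(x <- r | P x) \sum_(y <- s | below y x) f y = \sum_(y <- s | Q y) f y.
Proof.
move=> ur parent; rewrite (exchange_big_dep xpredT) //= [RHS]big_mkcond.
rewrite big_seq [RHS]big_seq; apply: eq_bigr => y /parent[x0 x0r [belowE PQ]].
rewrite big_mkcond (bigD1_seq x0) //= belowE // eqxx andbT PQ big_seq_cond.
rewrite [X in _ + X]big1 ?addr0 // => x /andP[xr ne_x].
by rewrite belowE // (negPf ne_x) andbF.
Qed.

Lemma sum_grid_rows (V : zmodType) (h v : nat -> nat -> V) (M N : nat) :
  (forall i j, (i < M)%N -> (j < N)%N ->
    h i j + v i j.+1 = v i j + h i.+1 j) ->
  (forall i, (i < M)%N -> v i 0%N = v i N) ->
  \sum_(0 <= j < N) h 0%N j = \sum_(0 <= j < N) h M j.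
Proof.
move=> square sides.
have row i j : (i < M)%N -> (j <= N)%N ->
    \sum_(0 <= l < j) h i l + v i j = v i 0%N + \sum_(0 <= l < j) h i.+1 l.
  move=> iM; elim: j => [|j IHj] jN; first by rewrite !big_geq // addrC.
  by rewrite !big_nat_recr //= -addrA square // addrA IHj ?addrA // ltnW.
suff rows i : (i <= M)%N ->
    \sum_(0 <= j < N) h i j = \sum_(0 <= j < N) h 0%N j by rewrite rows.
elim: i => // i IHi iM; rewrite -IHi 1?ltnW //; apply: (addIr (v i N)).
by rewrite [RHS]row // -sides // addrC.
Qed.

(** * Linear forms and spans of rows *)

Section RowForm.
Context {T : comNzRingType} {m n : nat} (L : 'M[T]_(m, n)).
Implicit Types (x w : 'rV[T]_n) (i : 'I_m).

Definition row_form i x : T := (L *m x^T) i ord0.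

Lemma row_formE i x : row_form i x = \sum_j L i j * x ord0 j.
Proof. by rewrite /row_form mxE; apply: eq_bigr => j _; rewrite !mxE. Qed.

Lemma row_formD i x w : row_form i (x + w) = row_form i x + row_form i w.
Proof. by rewrite /row_form raddfD mulmxDr mxE. Qed.

Lemma row_formZ (t : T) i x : row_form i (t *: x) = t * row_form i x.
Proof. by rewrite /row_form linearZ -scalemxAr mxE. Qed.

Lemma row_formN i x : row_form i (- x) = - row_form i x.
Proof. by rewrite -scaleN1r row_formZ mulN1r. Qed.

Lemma row_formB i x w : row_form i (x - w) = row_form i x - row_form i w.
Proof. by rewrite row_formD row_formN. Qed.

Lemma row_mul_tr i x : row i L *m x^T = (row_form i x)%:M.
Proof. by apply/matrixP => a c; rewrite !ord1 -row_mul mxE [RHS]mxE mulr1n. Qed.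

End RowForm.

Lemma row_form_map (S T : comNzRingType) (f : {rmorphism S -> T}) m n
    (L : 'M[S]_(m, n)) i (x : 'rV[S]_n) :
  row_form (map_mx f L) i (map_mx f x) = f (row_form L i x).
Proof.
rewrite !row_formE rmorph_sum; apply: eq_bigr => j _.
by rewrite !mxE rmorphM.
Qed.

Lemma row_form_continuous (R : realType) m n (L : 'M[R]_(m, n)) i :
  continuous (row_form L i).
Proof.
rewrite (_ : row_form L i = fun x => \sum_j L i j * x ord0 j); last first.
  by apply/funext => x; exact: row_formE.
apply: continuous_big => [|j _ x]; first exact: add_continuous.
apply: (@cvgM _ _ (nbhs (x : 'rV[R]_n))); first exact: cvg_cst.
exact: coord_continuous.
Qed.

Section RowSpan.
Context {F : fieldType} {m n : nat} (L : 'M[F]_(m, n)).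
Implicit Types (v : 'rV[F]_n) (I J : {set 'I_m}).

Definition row_span I : 'M[F]_n := (\sum_(i in I) <<row i L>>)%MS.
Definition row_rank I : nat := \rank (row_span I).
Definition essential I : bool := row_full (row_span I).

Lemma row_sub_span I i : i \in I -> (row i L <= row_span I)%MS.
Proof. by move=> iI; rewrite -genmxE; apply: sumsmx_sup iI _. Qed.

Lemma row_span_subP I p (B : 'M[F]_(p, n)) :
  (forall i, i \in I -> (row i L <= B)%MS) -> (row_span I <= B)%MS.
Proof. by move=> LB; apply/sumsmx_subP => i iI; rewrite genmxE LB. Qed.

Lemma row_spanS I J : I \subset J -> (row_span I <= row_span J)%MS.
Proof.
move=> /fintype.subsetP IJ; apply: row_span_subP => i /IJ; exact: row_sub_span.
Qed.

Lemma row_rank0 : row_rank finset.set0 = 0%N.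
Proof. by rewrite /row_rank /row_span big_set0 mxrank0. Qed.

Lemma row_span_comb I j : (row j L <= row_span I)%MS ->
  exists c : 'I_m -> F, forall v,
    row_form L j v = \sum_(i in I) c i * row_form L i v.
Proof.
move=> /sub_sumsmxP[u row_j].
have scaled i : exists c : F, u i *m <<row i L>>%MS = c *: row i L.
  by apply/sub_rVP; rewrite -(genmxE (row i L)); exact: submxMl.
have [c uE] := choice scaled; exists c => v.
suff : (row_form L j v)%:M = (\sum_(i in I) c i * row_form L i v)%:M :> 'M[F]_1.
  by move/matrixP/(_ ord0 ord0); rewrite !mxE !mulr1n.
rewrite -row_mul_tr row_j mulmx_suml raddf_sum; apply: eq_bigr => i _ /=.
by rewrite uE -scalemxAl row_mul_tr scale_scalar_mx.
Qed.

Lemma row_span_vanish I j v : (row j L <= row_span I)%MS ->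
  (forall i, i \in I -> row_form L i v = 0) -> row_form L j v = 0.
Proof.
by move=> /row_span_comb[c ->] v0; rewrite big1 // => i iI; rewrite v0 // mulr0.
Qed.

Lemma row_span_separate I j : ~~ (row j L <= row_span I)%MS ->
  exists v, (forall i, i \in I -> row_form L i v = 0) /\ row_form L j v = 1.
Proof.
set K := cokermx (row_span I); rewrite submxE -/K => /rV0Pn[k jk0].
set c := (X in X != 0) in jk0.
have formK i : row_form L i (c^-1 *: (col k K)^T) =
    c^-1 * (row i L *m K) ord0 k.
  rewrite row_formZ; congr (_ * _); have := row_mul_tr L i (col k K)^T.
  rewrite trmxK [X in _ *m X]colE mulmxA -[X in X = _]colE.
  by move=> /matrixP/(_ ord0 ord0); rewrite mxE [RHS]mxE mulr1n.
exists (c^-1 *: (col k K)^T); split=> [i /row_sub_span|].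
  by rewrite submxE formK => /eqP ->; rewrite mxE mulr0.
by rewrite formK mulVf.
Qed.

Lemma row_rank_setU1 I j :
  row_rank (j |: I) = (row_rank I + ~~ (row j L <= row_span I)%MS)%N.
Proof.
have -> : row_rank (j |: I) = \rank (row j L + row_span I)%MS.
  apply/eqP; rewrite eqn_leq !mxrankS //.
    rewrite addsmx_sub row_sub_span ?setU11 //= row_spanS //.
    exact: finset.subsetUr.
  apply: row_span_subP => i /setU1P[->|/row_sub_span rowi].
    exact: addsmxSl.
  by apply: submx_trans rowi _; exact: addsmxSr.
rewrite /row_rank; case: (boolP (row j L <= _)%MS) => rowj.
  by rewrite addn0 (addsmx_idPr rowj).
apply/eqP; rewrite eqn_leq; apply/andP; split.
  apply: leq_trans (mxrank_adds_leqif _ _) _.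
  by rewrite addnC leq_add2l rank_leq_row.
rewrite addn1; apply: rank_ltmx; rewrite ltmxE addsmxSr /=.
by apply: contra rowj => /(submx_trans (addsmxSl _ _)).
Qed.

Lemma essentialS I J : I \subset J -> essential I -> essential J.
Proof.
by move=> /row_spanS IJ; rewrite /essential -!sub1mx => /submx_trans; exact.
Qed.

Lemma essential_row I j : essential I -> (row j L <= row_span I)%MS.
Proof. exact: submx_full. Qed.

Lemma essential_exists_row I :
  essential [set: 'I_m]%SET -> ~~ essential I ->
  exists j, ~~ (row j L <= row_span I)%MS.
Proof.
rewrite /essential -!sub1mx => full nfull; apply: contrapT => nrow.
case/negP: nfull; apply: submx_trans full _; apply: row_span_subP => j _.
by apply: contrapT => /negP rowj; apply: nrow; exists j.
Qed.

Lemma essential_row_setD1 I j : j \in I ->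
  essential I -> ~~ essential (I :\ j) -> ~~ (row j L <= row_span (I :\ j))%MS.
Proof.
move=> jI; rewrite -{1}(finset.setD1K jI) /essential /row_full.
rewrite -!/(row_rank _) row_rank_setU1.
by case: (row j L <= _)%MS; rewrite ?addn0 // => ->.
Qed.

Lemma essential_inj I v : essential I ->
  (forall i, i \in I -> row_form L i v = 0) -> v = 0.
Proof.
rewrite /essential -sub1mx => full v0.
have : (row_span I <= kermx v^T)%MS.
  apply: row_span_subP => i iI; apply/sub_kermxP.
  by rewrite row_mul_tr v0 ?raddf0.
move=> /(submx_trans full)/sub_kermxP; rewrite mul1mx => /(congr1 trmx).
by rewrite trmxK trmx0.
Qed.

Lemma row_sub_span_setT : (L <= row_span [set: 'I_m]%SET)%MS.
Proof. by apply/row_subP => i; apply: row_sub_span; rewrite finset.in_setT. Qed.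

End RowSpan.

(** * Primitive integral normals *)

Lemma rat_mx_scale_int m n (a : 'M[rat]_(m, n)) :
  exists (d : int) (l : 'M[int]_(m, n)), d != 0 /\ d%:~R *: a = map_mx intr l.
Proof.
exists (\prod_(p : 'I_m * 'I_n) denq (a p.1 p.2)).
exists (\matrix_(i, j) (numq (a i j) *
  \prod_(p : 'I_m * 'I_n | p != (i, j)) denq (a p.1 p.2))); split.
  by apply/prodf_neq0 => p _; exact: denq_neq0.
apply/matrixP => i j; rewrite !mxE (bigD1 (i, j)) //= !intrM mulrAC.
rewrite -{2}[a i j]divq_num_den.
by congr (_ * _); rewrite mulrC divfK // intr_eq0 denq_neq0.
Qed.

Lemma int_row_primitive n (l : 'rV[int]_n) : l != 0 ->
  exists (g : int) (l' z : 'rV[int]_n), l = g *: l' /\ row_form l' ord0 z = 1.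
Proof.
case: n l => [|n] l l0; first by rewrite thinmx0 eqxx in l0.
have [U _ [V Vunit [d _ lE]]] := int_Smith_normal_form l.
exists (U ord0 ord0 * d`_0), (row ord0 V), (col ord0 (invmx V))^T; split.
  apply/rowP => j; rewrite {1}lE -mulmxA mxE big_ord1 mxE big_ord_recl.
  by rewrite big1 ?addr0 => [|k _]; rewrite !mxE ?mul0r ?mulrA.
rewrite /row_form trmxK !mxE; transitivity ((V *m invmx V) ord0 ord0).
  by rewrite mxE; apply: eq_bigr => k _; rewrite !mxE.
by rewrite mulmxV // mxE.
Qed.

Lemma rat_row_primitive n (a : 'rV[rat]_n) : a != 0 ->
  exists (c : rat) (l z : 'rV[int]_n),
    [/\ c != 0, a = c *: map_mx intr l & row_form l ord0 z = 1].
Proof.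
move=> a0; have [d [l0 [d0 al0]]] := rat_mx_scale_int a.
have dq : d%:~R != 0 :> rat by rewrite intr_eq0.
have l0_neq0 : l0 != 0.
  apply: contraNneq a0 => l0_eq0; move: al0; rewrite l0_eq0 map_mx0 => /eqP.
  by rewrite scaler_eq0 (negPf dq).
have [g [l [z [l0E lz]]]] := int_row_primitive l0_neq0.
have aE : a = (d%:~R^-1 * g%:~R) *: map_mx intr l.
  by apply: (scalerI dq); rewrite al0 l0E map_mxZ scalerA mulrA mulfV ?mul1r.
exists (d%:~R^-1 * g%:~R), l, z; split=> //.
by apply: contraNneq a0 => c0; rewrite aE c0 scale0r.
Qed.

Definition primitive_rows m n (A : 'M[int]_(m, n)) : Prop :=
  forall i, exists z, row_form A i z = 1.

Lemma not_essential_int_kernel (F : numFieldType) m n (A : 'M[int]_(m, n)) :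
  ~~ essential (map_mx intr A : 'M[F]_(m, n)) [set: 'I_m]%SET ->
  exists2 v : 'rV[int]_n, v != 0 & forall i, row_form A i v = 0.
Proof.
move=> ness; pose Aq : 'M[rat]_(m, n) := map_mx intr A.
have rank_Aq : (\rank Aq < n)%N.
  rewrite -(mxrank_map (@ratr F)); apply: contraR ness.
  rewrite -leqNgt /essential /row_full => nA.
  rewrite eqn_leq rank_leq_col; apply: leq_trans nA _; apply: mxrankS.
  have -> : map_mx ratr Aq = map_mx intr A :> 'M[F]_(m, n).
    by apply/matrixP => i j; rewrite !mxE ratr_int.
  exact: row_sub_span_setT.
have : kermx Aq^T != 0.
  by rewrite -mxrank_eq0 mxrank_ker mxrank_tr -lt0n subn_gt0.
move=> /rowV0Pn[u /sub_kermxP uA u0].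
have [d [v [d0 uv]]] := rat_mx_scale_int u.
have dq : d%:~R != 0 :> rat by rewrite intr_eq0.
exists v => [|i].
  apply: contraNneq u0 => v0; move: uv; rewrite v0 map_mx0 => /eqP.
  by rewrite scaler_eq0 (negPf dq).
apply/eqP; rewrite -(intr_eq0 rat) -row_form_map -uv row_formZ /row_form.
by rewrite -[map_mx intr A]trmxK -trmx_mul uA trmx0 mxE mulr0.
Qed.

(** * The poset of a family of sets *)

Section SetPoset.
Context {T : Type} (P : {fset (set T)^d}).

Lemma le_dual_set (X Y : (set T)^d) :
  (X <= Y)%O = `[< (Y : set T) `<=` X >].
Proof. by apply/idP/asboolP; rewrite leEdual => /subsetPset. Qed.

Lemma lt_dual_set (X Y : (set T)^d) :
  (X < Y)%O = (X != Y) && `[< (Y : set T) `<=` X >].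
Proof. by rewrite lt_neqAle le_dual_set. Qed.

Lemma sum_mobius_setT (X : set T) : X \in P ->
  \sum_(Y <- P | `[< X `<=` (Y : set T) >]) mobius P setT Y = (X == setT)%:Z.
Proof.
move=> XP; have [XT|XnT] := eqVneq X setT.
  rewrite XT in XP *; rewrite big_mkcond.
  rewrite (bigD1_seq (setT : (set T)^d)) ?fset_uniq //= asboolT //.
  rewrite mobius_refl big1 // => Y /eqP YnT.
  by case: asboolP => // TY; case: YnT; apply/seteqP.
have TX : ((setT : (set T)^d) < X)%O by rewrite lt_dual_set eq_sym XnT asboolT.
rewrite -[RHS](@mobius_sum _ _ P setT X XP TX); apply: eq_bigl => Y.
by rewrite !le_dual_set (asboolT (@subsetT _ Y)).
Qed.

Lemma covered_in_set1 (p : T) : [set p] \in P -> set0 \in P ->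
  covered_in P [set p] set0.
Proof.
move=> pP P0; have p0 : [set p] != set0 by apply/set0P; exists p.
rewrite /covered_in pP P0 lt_dual_set p0 asboolT //=; apply/allP => Y _.
rewrite !lt_dual_set; apply/negP => /andP[/andP[pY /asboolP Yp] /andP[Y0 _]].
case/negP: pY; apply/eqP/seteqP; split=> // _ ->.
by have /set0P[q Yq] := Y0; have /= <- := Yp q Yq.
Qed.

Lemma not_covered_in_set0 (X Y : set T) :
  Y \in P -> Y != set0 -> Y `<=` X -> X != Y -> ~~ covered_in P X set0.
Proof.
move=> YP Y0 YX XY; apply/negP => /and4P[_ _ _ /allP/(_ Y YP)/negP]; apply.
by rewrite !lt_dual_set XY Y0 !asboolT.
Qed.

End SetPoset.

Lemma card_fset_indicator (T : choiceType) (P Q : {fset T}) :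
  (P `<=` Q)%fset -> #|` P|%:Z = \sum_(x <- Q) (x \in P)%:Z.
Proof.
move=> PQ; transitivity (\sum_(x <- P) (x \in P)%:Z).
  rewrite big_seq (eq_bigr (fun=> 1)) => [|x ->//].
  by rewrite -big_seq big_const_seq count_predT iter_addr_0 natz.
by apply: big_fset_incl => // x _ /negPf ->.
Qed.

(** * The subdivision of the line by the integers *)

Section FaceIndex.
Context {R : realType}.
Implicit Types y : R.

(* [2k] at the integer [k], and [2k + 1] on the open interval [(k, k + 1)]. *)
Definition face_index y : int := Num.floor y + Num.ceil y.

(* [(k - 1, k + 1)] at the integer [k], and [(k, k + 1)] on that interval. *)
Definition face_star y : set R :=
  [set y' | (Num.ceil y)%:~R - 1 < y' < (Num.floor y)%:~R + 1].

Lemma floor_ceilP y :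
  [/\ y = (Num.floor y)%:~R, Num.ceil y = Num.floor y & y \is a Num.int] \/
  [/\ (Num.floor y)%:~R < y < (Num.floor y)%:~R + 1,
      Num.ceil y = Num.floor y + 1 & y \isn't a Num.int].
Proof.
have /andP[fy yf] := floor_itv y; rewrite ceil_floor.
case: (boolP (y \is a Num.int)) => yint; [left|right].
  by split=> //=; rewrite ?addr0 ?floorK.
split=> //; rewrite intrD in yf; rewrite yf lt_neqAle fy !andbT.
by rewrite -intrEfloor.
Qed.

Lemma even_face_index y : (2 %| face_index y)%Z = (y \is a Num.int).
Proof.
rewrite /face_index; case: (floor_ceilP y) => -[_ -> yint].
  by rewrite yint; apply/dvdzP; exists (Num.floor y); lia.
by rewrite (negPf yint); apply/negP => /dvdzP[q]; lia.
Qed.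

Lemma face_indexDz y (k : int) : face_index (y + k%:~R) = face_index y + 2 * k.
Proof.
rewrite /face_index floorDrz ?ceilDrz ?intr_int // intrKfloor intrKceil.
by rewrite addrACA -[k + k]mulr2n mulr_natl.
Qed.

Lemma le_face_index : {homo face_index : y y' / y <= y'}.
Proof. by move=> y y' yy'; apply: lerD; [exact: le_floor|exact: le_ceil]. Qed.

Lemma lt_face_index y y' : face_index y < face_index y' -> y < y'.
Proof. by rewrite !ltNge; apply: contra => /le_face_index. Qed.

Lemma face_index_half (c : int) : face_index (c%:~R / 2) = c.
Proof.
rewrite [in LHS](divz_eq c 2) /face_index.
set q := (c %/ 2)%Z; have [r0|r1] : (c %% 2)%Z = 0 \/ (c %% 2)%Z = 1 by lia.
  have -> : (q * 2 + (c %% 2)%Z)%:~R / 2 = q%:~R :> R.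
    by rewrite r0 addr0 intrM; field.
  by rewrite intrKfloor intrKceil; lia.
rewrite r1 (@floor_def _ _ q) ?(@ceil_def _ _ (q + 1)); try lia.
  by rewrite addrK !intrD intrM; apply/andP; split; lra.
by rewrite !intrD intrM; apply/andP; split; lra.
Qed.

Lemma half_not_int : (2^-1 : R) \isn't a Num.int.
Proof. by rewrite -even_face_index -[2^-1]mul1r (face_index_half 1). Qed.

Lemma face_index_eq_floor y y' : face_index y = face_index y' ->
  Num.floor y = Num.floor y' /\ Num.ceil y = Num.ceil y'.
Proof.
rewrite /face_index.
by case: (floor_ceilP y) => -[_ -> _]; case: (floor_ceilP y') => -[_ -> _]; lia.
Qed.

Lemma face_index_eq_int y y' : face_index y = face_index y' ->
  (y \is a Num.int) = (y' \is a Num.int).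
Proof. by move=> yy'; rewrite -!even_face_index yy'. Qed.

Lemma face_index_int_inj y y' :
  y \is a Num.int -> face_index y = face_index y' -> y = y'.
Proof.
move=> yint yy'; have y'int := yint; rewrite (face_index_eq_int yy') in y'int.
by have [fyy' _] := face_index_eq_floor yy'; rewrite -(floorK yint) fyy' floorK.
Qed.

Lemma face_index_eq_dist y y' : face_index y = face_index y' -> `|y' - y| < 1.
Proof.
move=> /face_index_eq_floor[fyy' _].
have /andP[fy yf] := floor_itv y; have /andP[fy' y'f] := floor_itv y'.
by rewrite ltr_norml; rewrite fyy' !intrD in fy yf y'f; lra.
Qed.

Lemma face_index_convex y y' (t : R) : face_index y = face_index y' ->
  0 <= t <= 1 -> face_index (y + t * (y' - y)) = face_index y.
Proof.
wlog yy' : y y' t / y <= y' => [convex_le eq_index t01|].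
  case: (leP y y') => yy'; first exact: convex_le.
  have -> : y + t * (y' - y) = y' + (1 - t) * (y - y') by ring.
  by rewrite eq_index; apply: convex_le; [exact: ltW| |lra].
move=> eq_index /andP[t0 t1]; apply/eqP; rewrite eq_le {1}eq_index.
have : 0 <= y' - y by rewrite subr_ge0.
by rewrite !le_face_index //; nra.
Qed.

Lemma face_star_refl y : face_star y y.
Proof.
have /andP[_ yf] := floor_itv y; rewrite intrD in yf.
have /andP[yc _] := ceil_itv y; rewrite intrB in yc.
by rewrite /face_star /=; lra.
Qed.

Lemma face_star_eq y y' : face_index y = face_index y' ->
  face_star y = face_star y'.
Proof. by rewrite /face_star => /face_index_eq_floor[-> ->]. Qed.

Lemma open_face_star y : open (face_star y).
Proof.
suff -> : face_star y =
    `](Num.ceil y)%:~R - 1, (Num.floor y)%:~R + 1[%classic.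
  exact: interval_open.
by apply/seteqP; split=> x /=; rewrite in_itv.
Qed.

Lemma face_star_floor_ceil y y' : face_star y y' ->
  Num.ceil y - 1 < Num.ceil y' /\ Num.floor y' < Num.floor y + 1.
Proof. by move=> /andP[]; rewrite ceil_gt_int floor_lt_int intrB intrD. Qed.

Lemma face_index_star y y' : face_star y y' ->
  (y \is a Num.int) = (y' \is a Num.int) -> face_index y' = face_index y.
Proof.
move=> /face_star_floor_ceil[cyy' fyy'].
case: (floor_ceilP y) => -[_ cy yint]; case: (floor_ceilP y') => -[_ cy' y'int];
  rewrite /face_index ?yint ?y'int ?(negPf yint) ?(negPf y'int) // => _;
  lia.
Qed.

Lemma face_index_star_nonint y y' : y \isn't a Num.int -> face_star y y' ->
  face_index y' = face_index y.
Proof.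
move=> ynint /face_star_floor_ceil[cyy' fyy'].
case: (floor_ceilP y) => -[_ cy yint]; first by rewrite yint in ynint.
by rewrite /face_index; case: (floor_ceilP y') => -[_ cy' _]; lia.
Qed.

Lemma face_index_star_lt y y' : y \is a Num.int -> face_star y y' -> y' < y ->
  face_index y' = face_index y - 1.
Proof.
move=> yint /face_star_floor_ceil[cyy' _] y'y.
have {}y'y : Num.floor y' < Num.floor y by rewrite floor_lt_int floorK.
case: (floor_ceilP y) => -[_ cy]; last by rewrite yint.
by rewrite /face_index; case: (floor_ceilP y') => -[_ cy' _] _; lia.
Qed.

Lemma face_index_star_gt y y' : y \is a Num.int -> face_star y y' -> y < y' ->
  face_index y' = face_index y + 1.
Proof.
move=> yint /face_star_floor_ceil[_ fyy'] yy'.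
have {}yy' : Num.floor y < Num.ceil y' by rewrite ceil_gt_int floorK.
case: (floor_ceilP y) => -[_ cy]; last by rewrite yint.
by rewrite /face_index; case: (floor_ceilP y') => -[_ cy' _] _; lia.
Qed.

End FaceIndex.

Definition flip_parity (c : int) : int := if (2 %| c)%Z then c + 1 else c - 1.

Lemma flip_parityD (c k : int) :
  flip_parity (c + 2 * k) = flip_parity c + 2 * k.
Proof. by rewrite /flip_parity rpredDr ?dvdz_mulr //; case: ifP; lia. Qed.

Lemma flip_parityK : involutive flip_parity.
Proof.
move=> c; rewrite /flip_parity.
by case: (boolP (2 %| c)%Z) => c2; case: ifP => fc2; lia.
Qed.

Lemma even_flip_parity c : (2 %| flip_parity c)%Z = ~~ (2 %| c)%Z.
Proof. by rewrite /flip_parity; case: (boolP (2 %| c)%Z) => c2; lia. Qed.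

(** * The torus as a quotient of [R^n] *)

Section TorusProjection.
Context {R : realType} {n : nat}.
Implicit Types (x w v : 'rV[R]_n) (z : 'rV[int]_n) (p : torus R n).

Local Notation proj := (@torus_proj R n).

Definition lattice_vec z : 'rV[R]_n := map_mx intr z.

Lemma lattice_vecN z : lattice_vec (- z) = - lattice_vec z.
Proof. exact: map_mxN. Qed.

Lemma torus_proj_eq x w : proj x = proj w <-> exists z, w = x + lattice_vec z.
Proof.
split=> [/eqmodP /= /forallP xw|[z ->]]; last first.
  by apply/eqmodP/forallP => j; rewrite !mxE opprD addNKr rpredN intr_int.
exists (\row_j Num.floor (w ord0 j - x ord0 j)).
by apply/rowP => j; rewrite !mxE floorK; [ring|rewrite -opprB rpredN].
Qed.

Lemma torus_proj_lattice x z : proj (x + lattice_vec z) = proj x.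
Proof. by apply/esym/torus_proj_eq; exists z. Qed.

Lemma torus_proj_repr p : proj (repr p) = p.
Proof. by rewrite /torus_proj reprK. Qed.

Lemma torus_proj_surj p : exists x, proj x = p.
Proof. by exists (repr p); exact: torus_proj_repr. Qed.

Lemma torus_proj_continuous : continuous proj.
Proof. exact: pi_continuous. Qed.

Lemma torus_line_continuous x v : continuous (fun t : R => proj (x + t *: v)).
Proof.
move=> t; apply: (@continuous_comp _ _ _ (fun t : R => x + t *: v) proj).
  by apply: cvgD; [exact: cvg_cst|apply: cvgZr_tmp; exact: cvg_id].
exact: torus_proj_continuous.
Qed.

Lemma open_torus_proj (U : set 'rV[R]_n) : open U -> open (proj @` U).
Proof.
move=> openU; rewrite /open/= /quotient_open.
have -> : (\pi_(torus R n)%qT @^-1` (proj @` U)) =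
    \bigcup_(z in [set: 'rV[int]_n]) [set x | U (lattice_vec z + x)].
  apply/seteqP; split => x /=.
    move=> [w Uw /esym/torus_proj_eq[z wE]].
    by exists z => //=; rewrite addrC -wE.
  move=> [z _ /= Ux]; exists (lattice_vec z + x) => //.
  by rewrite addrC torus_proj_lattice.
apply: bigcup_open => z _; apply: open_comp => // x _.
by apply: (@cvgD _ _ _ (nbhs (x : 'rV[R]_n))); [exact: cvg_cst|exact: cvg_id].
Qed.

Lemma torus_proj_affine_set1 (k : nat) (p : 'rV[R]_n) (V : 'M[R]_(k, n)) x :
  row_free V ->
  [set proj x] = proj @` [set y | exists u : 'rV[R]_k, y = p + u *m V] ->
  k = 0%N.
Proof.
case: k V => // k V freeV xE; exfalso.
have proj_pV u : proj (p + u *m V) = proj x.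
  have : (proj @` [set y | exists u, y = p + u *m V]) (proj (p + u *m V)).
    by exists (p + u *m V) => //; exists u.
  by rewrite -xE.
have /rV0Pn[j Vj] : delta_mx ord0 ord0 *m V != 0 :> 'rV[R]_n.
  rewrite mulmx_free_eq0 //; apply/eqP => /matrixP/(_ ord0 ord0)/eqP.
  by rewrite !mxE !eqxx oner_eq0.
set Vj0 := (X in X != 0) in Vj.
have := proj_pV ((2 * Vj0)^-1 *: delta_mx ord0 ord0); rewrite -(proj_pV 0).
move=> /esym/torus_proj_eq[z] /rowP/(_ j).
rewrite mul0mx addr0 -scalemxAl [LHS]mxE [RHS]mxE => /addrI.
rewrite [LHS]mxE [RHS]mxE -/Vj0 => half_z.
have zE : (z ord0 j)%:~R = 2^-1 :> R by rewrite -half_z; field.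
by have := half_not_int (R := R); rewrite -zE intr_int.
Qed.

Lemma toric_rank_set1 p : toric_rank [set p] = n.
Proof.
have [x <-] := torus_proj_surj p; rewrite /toric_rank ifN; last first.
  by apply/set0P; exists (proj x).
rewrite /toric_dim; case: xgetP => [k _ [q [V [freeV xE]]]|_].
  by rewrite (torus_proj_affine_set1 freeV xE) subn0.
exact: subn0.
Qed.

Lemma lattice_reduce x :
  exists z, forall j, 0 <= (x + lattice_vec z) ord0 j < 1.
Proof.
exists (\row_j (- Num.floor (x ord0 j))) => j; rewrite !mxE intrN.
have /andP[fx xf] := floor_itv (x ord0 j).
by rewrite subr_ge0 fx /= ltrBlDl; rewrite intrD in xf.
Qed.

End TorusProjection.

(** * Faces of a periodic arrangement *)

Section Arrangement.
Context {R : realType} {n m : nat} (A : 'M[int]_(m, n)) (b : 'I_m -> R).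
Implicit Types (x w v : 'rV[R]_n) (z : 'rV[int]_n) (i j : 'I_m).
Implicit Types (I J S : {set 'I_m}) (F G Y : set (torus R n)).

Local Notation proj := (@torus_proj R n).
Local Notation form := (row_form (map_mx intr A : 'M[R]_(m, n))).
Local Notation span := (row_span (map_mx intr A : 'M[R]_(m, n))).
Local Notation rank := (row_rank (map_mx intr A : 'M[R]_(m, n))).
Local Notation essential := (essential (map_mx intr A : 'M[R]_(m, n))).

Definition level i x : R := form i x - b i.

Definition wall i : set (torus R n) :=
  proj @` [set x | level i x \is a Num.int].

Definition walls x : {set 'I_m} := [set i | level i x \is a Num.int].

Lemma levelD i x w : level i (x + w) = level i x + form i w.
Proof. by rewrite /level row_formD addrAC. Qed.

Lemma level_lattice i x z :
  level i (x + lattice_vec z) = level i x + (row_form A i z)%:~R.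
Proof. by rewrite levelD row_form_map. Qed.

Lemma levelB i x w : level i w - level i x = form i (w - x).
Proof. by rewrite row_formB /level; ring. Qed.

Lemma level_segment i x w (t : R) :
  level i (x + t *: (w - x)) = level i x + t * (level i w - level i x).
Proof. by rewrite levelD row_formZ levelB. Qed.

Lemma level_line i x v (t : R) : form i v = 0 ->
  level i (x + t *: v) = level i x.
Proof. by move=> v0; rewrite levelD row_formZ v0 mulr0 addr0. Qed.

Definition slide j v (c : int) x : 'rV[R]_n :=
  x + (c%:~R / 2 - level j x) *: v.

Lemma face_index_slide j v c x : form j v = 1 ->
  face_index (level j (slide j v c x)) = c.
Proof.
by move=> v1; rewrite levelD row_formZ v1 mulr1 addrC subrK face_index_half.
Qed.

Lemma level_continuous i : continuous (level i).
Proof.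
move=> x; apply: (@cvgB _ _ _ (nbhs (x : 'rV[R]_n))); last exact: cvg_cst.
exact: row_form_continuous.
Qed.

Lemma walls_lattice x z : walls (x + lattice_vec z) = walls x.
Proof. by apply/setP => i; rewrite !inE level_lattice rpredDr ?intr_int. Qed.

Lemma wall_proj i x : wall i (proj x) <-> i \in walls x.
Proof.
rewrite inE; split=> [[w wi /torus_proj_eq[z ->]]|xi]; last by exists x.
by rewrite level_lattice rpredDr ?intr_int.
Qed.

Definition face_lift I x : set 'rV[R]_n :=
  [set w | forall i, i \in I ->
    face_index (level i w) = face_index (level i x)].

Definition face I x : set (torus R n) := proj @` face_lift I x.

Definition faces I : set (set (torus R n)) := range (face I).

Lemma face_index_lattice i x z :
  face_index (level i (x + lattice_vec z)) =
  face_index (level i x) + 2 * row_form A i z.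
Proof. by rewrite level_lattice face_indexDz. Qed.

Lemma face_lift_eq I x w : face_lift I x w -> face_lift I w = face_lift I x.
Proof. by move=> xw; apply/seteqP; split=> y y_in i iI; rewrite y_in // xw. Qed.

Lemma face_lift_convex I x w (t : R) : face_lift I x w -> 0 <= t <= 1 ->
  face_lift I x (x + t *: (w - x)).
Proof.
by move=> xw t01 i iI; rewrite level_segment face_index_convex // xw.
Qed.

Lemma face_lift_walls I x w i : face_lift I x w -> i \in I ->
  (i \in walls w) = (i \in walls x).
Proof. by move=> xw iI; rewrite !inE; apply: face_index_eq_int; apply: xw. Qed.

Lemma face_lift_wallsI I x w : face_lift I x w -> walls w :&: I = walls x :&: I.
Proof.
move=> xw; apply/setP => i; rewrite !finset.in_setI.
by case: (boolP (i \in I)) => iI; rewrite ?andbF // !andbT (face_lift_walls xw).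
Qed.

Lemma face_lift_level I x w i : face_lift I x w -> i \in walls x :&: I ->
  level i w = level i x.
Proof.
move=> xw; rewrite finset.in_setI inE => /andP[xi iI].
by apply/esym/face_index_int_inj => //; rewrite xw.
Qed.

Lemma face_refl I x : face I x (proj x).
Proof. by exists x. Qed.

Lemma face_projP I x w :
  face I x (proj w) <-> exists z, face_lift I x (w + lattice_vec z).
Proof.
split=> [[w' xw' /esym/torus_proj_eq[z w'E]]|[z xw]].
  by exists z; rewrite -w'E.
by exists (w + lattice_vec z); rewrite ?torus_proj_lattice.
Qed.

Lemma face_lattice I x z : face I (x + lattice_vec z) = face I x.
Proof.
have sub y z' : face I (y + lattice_vec z') `<=` face I y.
  move=> _ [w yw <-]; apply/face_projP; exists (- z') => i iI.
  by rewrite face_index_lattice yw // face_index_lattice row_formN; ring.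
apply/seteqP; split; first exact: sub.
by rewrite -{1}[x](addrK (lattice_vec z)) -lattice_vecN; exact: sub.
Qed.

Lemma face_eq_lift I x w : face_lift I x w -> face I w = face I x.
Proof. by move=> xw; rewrite /face (face_lift_eq xw). Qed.

Lemma face_eq I x w : face I x (proj w) -> face I w = face I x.
Proof. by move=> /face_projP[z /face_eq_lift <-]; rewrite face_lattice. Qed.

Lemma face_eqP I x w :
  face I w = face I x <-> exists z, face_lift I x (w + lattice_vec z).
Proof.
split=> [wx|[z /face_eq_lift]]; last by rewrite face_lattice.
by apply/face_projP; rewrite -wx; exact: face_refl.
Qed.

Lemma faceS I S x : S \subset I -> face I x `<=` face S x.
Proof.
move=> /fintype.subsetP SI _ [w xw <-]; exists w => // i /SI; exact: xw.
Qed.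

Lemma face_subP I S x w : S \subset I ->
  face I x `<=` face S w <-> exists z, face_lift S w (x + lattice_vec z).
Proof.
move=> SI; split=> [/(_ _ (face_refl I x))/face_projP //|/face_eqP <-].
exact: faceS.
Qed.

Lemma face_sub_wall I x i : i \in I -> face I x `<=` wall i <-> i \in walls x.
Proof.
move=> iI; split=> [/(_ _ (face_refl I x))/wall_proj //|xi _ [w xw <-]].
by apply/wall_proj; rewrite (face_lift_walls xw).
Qed.

Lemma face_set0 x : face finset.set0 x = setT.
Proof.
apply/seteqP; split=> // p _; have [w <-] := torus_proj_surj p.
by exists w => // i; rewrite finset.in_set0.
Qed.

Lemma face_neq0 I x : face I x != set0.
Proof. by apply/eqP => x0; have := face_refl I x; rewrite x0. Qed.

Lemma level_bounded i : exists M : R, forall x,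
  (forall k, 0 <= x ord0 k < 1) -> `|level i x| <= M.
Proof.
exists (\sum_k `|(A i k)%:~R| + `|b i|) => x x01.
apply: le_trans (ler_normB _ _) _; rewrite lerD2r row_formE.
apply: le_trans (ler_norm_sum _ _ _) _; apply: ler_sum => k _.
by rewrite mxE normrM ler_piMr //; have := x01 k; rewrite ler_norml; lra.
Qed.

Lemma finite_faces I : finite_set (faces I).
Proof.
have [M levelM] := choice level_bounded.
pose K := (\sum_i (absz (face_index (- M i)%R) + absz (face_index (M i))))%N.
pose face_of (c : {ffun 'I_m -> 'I_(K + K).+1}) : set (torus R n) :=
  proj @` [set w | forall i, i \in I ->
    face_index (level i w) = (c i)%:Z - K%:Z].
apply: (@sub_finite_set _ _ (face_of @` setT)); last first.
  by apply: finite_image; exact: finite_finset.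
move=> _ [x0 _ <-]; have [z x01] := lattice_reduce x0.
rewrite -(face_lattice _ x0 z); set x := x0 + _ in x01 *.
have indexK i : `|face_index (level i x)| <= K%:Z.
  have := levelM i x x01; rewrite ler_norml => /andP[Mx xM].
  have {}Mx : face_index (- M i) <= face_index (level i x) := le_face_index Mx.
  have {}xM : face_index (level i x) <= face_index (M i) := le_face_index xM.
  have : (absz (face_index (- M i)%R) + absz (face_index (M i)) <= K)%N.
    by rewrite /K (bigD1 i) //= leq_addr.
  by move: Mx xM; lia.
have ltK i : (absz (face_index (level i x) + K%:Z)%R < (K + K).+1)%N.
  by have := indexK i; lia.
exists [ffun i => Ordinal (ltK i)] => //.
congr (proj @` _); apply/seteqP; split=> w xw i iI; have := xw i iI;
  by rewrite ffunE /=; have := indexK i; set c := face_index (level i x); lia.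
Qed.

Lemma mem_faces I x : face I x \in fset_set (faces I).
Proof. by rewrite in_fset_set ?inE; [exists x|exact: finite_faces]. Qed.

Lemma facesP I F : F \in fset_set (faces I) -> exists x, F = face I x.
Proof.
by rewrite in_fset_set ?inE; [case=> x _ <-; exists x|exact: finite_faces].
Qed.

(** * Faces as connected components *)

Definition open_star I x : set 'rV[R]_n :=
  [set w | forall i, i \in I -> face_star (level i x) (level i w)].

Lemma open_star_refl I x : open_star I x x.
Proof. by move=> i _; exact: face_star_refl. Qed.

Lemma open_open_star I x : open (open_star I x).
Proof.
rewrite openE => w xw; rewrite /interior.
apply: (@filter_forall _ _ (fun i w' => i \in I ->
  face_star (level i x) (level i w')) (nbhs w)) => i.
case: (boolP (i \in I)) => iI; last exact: nearW.
have /(@level_continuous i w) starw : nbhs (level i w) (face_star (level i x)).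
  by apply: open_nbhs_nbhs; split; [exact: open_face_star|exact: xw].
by apply: (@filterS _ (nbhs w) _ _ _ _ starw) => w' /=.
Qed.

Lemma open_star_line I x v :
  exists2 e, 0 < e & forall t : R, `|t| <= e -> open_star I x (x + t *: v).
Proof.
have line : continuous (fun t : R => x + t *: v).
  by move=> t; apply: cvgD; [exact: cvg_cst|apply: cvgZr_tmp; exact: cvg_id].
have : nbhs (x + 0 *: v) (open_star I x).
  rewrite scale0r addr0; apply: open_nbhs_nbhs.
  by split; [exact: open_open_star|exact: open_star_refl].
move=> /line/nbhs_ballP[d /= d0 star_d]; exists (d / 2) => [|t td].
  by rewrite divr_gt0.
by apply: star_d; rewrite -ball_normE /= sub0r normrN; lra.
Qed.

Lemma open_star_face_lift I x w :
  open_star I x w -> walls w :&: I = walls x :&: I -> face_lift I x w.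
Proof.
move=> xw wallsE i iI; apply: face_index_star; first exact: xw.
by move/setP/(_ i): wallsE; rewrite !finset.in_setI iI !andbT !inE.
Qed.

Definition stratum I x : set (torus R n) :=
  proj @` [set w | walls w :&: I = walls x :&: I].

Lemma stratum_proj I x w :
  stratum I x (proj w) <-> walls w :&: I = walls x :&: I.
Proof.
split=> [[w' w'x /torus_proj_eq[z ->]]|wx]; last by exists w.
by rewrite walls_lattice.
Qed.

Lemma connected_face I x : connected (face I x).
Proof.
apply: connected_continuous_connected; last first.
  by apply: continuous_subspaceT; exact: torus_proj_continuous.
by apply: (@star_shaped_connected _ _ _ x) => // w t; exact: face_lift_convex.
Qed.

Lemma connected_component_stratum I x :
  connected_component (stratum I x) (proj x) = face I x.
Proof.
pose D := [set w | stratum I x (proj w)].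
apply: (@connected_component_relopen _ _ _ D (face I)
  (fun w => proj @` open_star I w)).
- move=> p; have [w <-] := torus_proj_surj p => xw.
  by exists w => //; exact: face_refl.
- move=> w /stratum_proj wx; split; first exact: connected_face.
    by apply: open_torus_proj; exact: open_open_star.
  apply/seteqP; split=> [p [xp [w' ww' w'p]]|_ [w' ww' <-]].
    exists w' => //; apply: open_star_face_lift => //.
    by rewrite wx; apply/stratum_proj; rewrite w'p.
  split; first by apply/stratum_proj; rewrite (face_lift_wallsI ww').
  exists w' => // i iI; rewrite -(face_star_eq (ww' i iI)).
  exact: face_star_refl.
- move=> w w' _ _ [p []]; have [y <-] := torus_proj_surj p.
  by move=> /face_eq <- /face_eq <-.
- by apply/stratum_proj.
- exact: face_refl.
Qed.

(** * Alternating sums over faces *)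

(* This is [(-1) ^ codim F], as the normals of the walls containing a face span
   the conormal space of that face. *)
Definition face_sign I F : int :=
  (-1) ^+ rank [set i in I | `[< F `<=` wall i >]]%SET.

Definition euler_sum I Y : int :=
  \sum_(F <- fset_set (faces I) | `[< F `<=` Y >]) face_sign I F.

Lemma face_signE I x : face_sign I (face I x) = (-1) ^+ rank (walls x :&: I).
Proof.
congr (_ ^+ rank _); apply/setP => i; rewrite !inE [RHS]andbC.
case: (boolP (i \in I)) => //= iI; apply/asboolP/idP => [/face_sub_wall|xi].
  by rewrite inE; exact.
by apply/face_sub_wall => //; rewrite inE.
Qed.

Lemma essential_face_lift_lattice I x w z : essential I ->
  face_lift I x w -> face_lift I x (w + lattice_vec z) ->
  lattice_vec z = 0 :> 'rV[R]_n.
Proof.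
move=> essI xw xwz; apply: (essential_inj essI) => i iI.
rewrite row_form_map; have := xwz i iI; rewrite face_index_lattice xw // => fz.
by have -> : row_form A i z = 0 by lia.
Qed.

Section Slices.
Context (I : {set 'I_m}) (j : 'I_m) (x : 'rV[R]_n).
Hypothesis essI : essential I.

Definition slice_indices : set int :=
  [set face_index (level j w) | w in face_lift I x].

Definition slice (c : int) : set (torus R n) :=
  proj @` [set w | face_lift I x w /\ face_index (level j w) = c].

Lemma slice_face w : face_lift I x w ->
  slice (face_index (level j w)) = face (j |: I) w.
Proof.
move=> xw; apply/seteqP; split=> _ [w' ww' <-]; exists w' => //.
  by case: ww' => xw' jw' i /setU1P[->//|iI]; rewrite xw' // xw.
split; last by apply: ww'; exact: setU11.
by move=> i iI; rewrite -(xw i iI); apply: ww'; apply/setU1P; right.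
Qed.

Lemma slice_inj c c' :
  slice_indices c -> slice_indices c' -> slice c = slice c' -> c = c'.
Proof.
move=> [w xw <-] [w' xw' <-]; rewrite !slice_face // => /face_eqP[z w'wz].
have <- := w'wz j (setU11 _ _); rewrite (essential_face_lift_lattice essI xw).
  by rewrite addr0.
by move=> i iI; rewrite w'wz ?xw' //; apply/setU1P; right.
Qed.

Lemma sum_slices (f : set (torus R n) -> int) (s : seq int) :
  uniq s -> (forall c, c \in s <-> slice_indices c) ->
  \sum_(G <- fset_set (faces (j |: I)) | `[< G `<=` face I x >]) f G =
  \sum_(c <- s) f (slice c).
Proof.
move=> us sP; rewrite -big_filter -(big_map slice xpredT f).
apply: perm_big; apply: uniq_perm.
- by rewrite filter_uniq // fset_uniq.
- by rewrite map_inj_in_uniq // => c c' /sP sc /sP sc'; exact: slice_inj.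
have IjI : I \subset j |: I by exact: finset.subsetUr.
move=> G; rewrite mem_filter; apply/andP/mapP.
  move=> [/asboolP Gx /facesP[w GE]]; subst G.
  have [z xwz] := (face_subP _ _ IjI).1 Gx.
  exists (face_index (level j (w + lattice_vec z))).
    by apply/sP; exists (w + lattice_vec z).
  by rewrite slice_face // face_lattice.
move=> [c /sP[w xw <-] ->]; rewrite slice_face //; split; last exact: mem_faces.
by apply/asboolP; rewrite -(face_eq_lift xw); exact: faceS.
Qed.

Local Notation dependent := (row j (map_mx intr A) <= span (walls x :&: I))%MS.

Lemma face_sign_slice w : face_lift I x w ->
  face_sign (j |: I) (face (j |: I) w) =
  face_sign I (face I x) * (-1) ^+ ((j \in walls w) && ~~ dependent).
Proof.
move=> xw; rewrite !face_signE finset.setIUr (face_lift_wallsI xw).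
case: (boolP (j \in walls w)) => jw /=.
  have /finset.setIidPr -> : [set j]%SET \subset walls w.
    by rewrite finset.sub1set.
  by rewrite row_rank_setU1 exprD.
have -> : walls w :&: [set j]%SET = finset.set0.
  by apply/eqP; rewrite finset.setI_eq0 disjoint_sym disjoints1.
by rewrite finset.set0U mulr1.
Qed.

Lemma dependent_slice_indices : dependent ->
  slice_indices = [set face_index (level j x)].
Proof.
move=> dep; apply/seteqP; split=> [_ [w xw <-] /=|_ ->]; last by exists x.
congr face_index; apply/eqP; rewrite -subr_eq0 levelB.
rewrite (row_span_vanish dep) // => i xi.
by rewrite -levelB (face_lift_level xw xi) subrr.
Qed.

Lemma slice_indices_bounded :
  exists M : int, forall c, slice_indices c -> `|c| <= M.
Proof.
have [c0 formE] := row_span_comb (essential_row j essI).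
pose D : R := \sum_(i in I) `|c0 i|.
exists (`|face_index (level j x - D)| + `|face_index (level j x + D)|).
move=> _ [w xw <-].
have : `|level j w - level j x| <= D.
  rewrite levelB formE; apply: le_trans (ler_norm_sum _ _ _) _.
  apply: ler_sum => i iI; rewrite normrM ler_piMr // -levelB.
  by apply/ltW/face_index_eq_dist; rewrite xw.
rewrite ler_norml => /andP[Dw wD].
have lo : face_index (level j x - D) <= face_index (level j w).
  by apply: le_face_index; lra.
have hi : face_index (level j w) <= face_index (level j x + D).
  by apply: le_face_index; lra.
by move: lo hi; lia.
Qed.

Lemma slice_indices_convex c1 c c2 :
  slice_indices c1 -> slice_indices c2 -> c1 <= c <= c2 -> slice_indices c.
Proof.
move=> [w1 xw1 <-] [w2 xw2 <-]; rewrite !le_eqVlt.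
case/andP => /predU1P[<-|lt1]; first by exists w1.
case/predU1P => [->|lt2]; first by exists w2.
rewrite -(face_index_half (R := R) c) in lt1 lt2.
have {}lt1 := lt_face_index lt1; have {}lt2 := lt_face_index lt2.
pose t := (c%:~R / 2 - level j w1) / (level j w2 - level j w1).
have lt12 : 0 < level j w2 - level j w1 by lra.
exists (w1 + t *: (w2 - w1)); last first.
  by rewrite level_segment divfK ?gt_eqF // addrC subrK face_index_half.
rewrite -(face_lift_eq xw1); apply: face_lift_convex.
  by rewrite (face_lift_eq xw1).
by rewrite divr_ge0 ?ler_pdivrMr //; lra.
Qed.

Lemma independent_slice_indices_odd c : ~~ dependent ->
  slice_indices c -> (2 %| c)%Z ->
  slice_indices (c - 1) /\ slice_indices (c + 1).
Proof.
move=> /row_span_separate[v [v0 vj]] [w xw <-]; rewrite even_face_index => jw.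
have [e e0 star_e] := open_star_line (j |: I) w v.
have face_t t : `|t| <= e -> face_lift I x (w + t *: v).
  move=> te i iI; rewrite -(xw i iI).
  case: (boolP (i \in walls x)) => xi.
    by rewrite level_line // v0 // finset.in_setI xi.
  apply: face_index_star_nonint.
    by move: xi; rewrite -(face_lift_walls xw iI) inE.
  by apply: star_e => //; apply/setU1P; right.
have levelj t : level j (w + t *: v) = level j w + t.
  by rewrite levelD row_formZ vj mulr1.
have ee : `|e| <= e by rewrite gtr0_norm.
have Nee : `|- e| <= e by rewrite normrN.
split.
  exists (w + - e *: v); first exact: face_t.
  apply: face_index_star_lt => //; last by rewrite levelj; lra.
  exact: star_e (setU11 _ _).
exists (w + e *: v); first exact: face_t.
apply: face_index_star_gt => //; last by rewrite levelj; lra.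
exact: star_e (setU11 _ _).
Qed.

Lemma independent_slice_indices : ~~ dependent ->
  exists (a : int) (N : nat), ~~ (2 %| a)%Z /\
    forall c, slice_indices c <-> a <= c <= a + (2 * N)%:Z.
Proof.
move=> indep; have [M boundM] := slice_indices_bounded.
have nonempty : slice_indices !=set0 by exists (face_index (level j x)), x.
have [a [e [Ka Ke Kae]]] :=
  int_set_interval nonempty boundM slice_indices_convex.
have odd_a : ~~ (2 %| a)%Z.
  by apply/negP => /(independent_slice_indices_odd indep Ka)[/Kae]; lia.
have odd_e : ~~ (2 %| e)%Z.
  by apply/negP => /(independent_slice_indices_odd indep Ke)[_ /Kae]; lia.
have le_ae : a <= e by move/Kae: Ka => /andP[].
exists a, (absz (e - a))./2; split=> // c.
have -> // : a + (2 * (absz (e - a))./2)%:Z = e.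
have : ~~ odd (absz (e - a)) by lia.
by lia.
Qed.

(* The slices of the face are alternately open slabs and walls, with slabs at
   both ends, unless there is only one. *)
Lemma face_sign_setU1 :
  \sum_(G <- fset_set (faces (j |: I)) | `[< G `<=` face I x >])
    face_sign (j |: I) G = face_sign I (face I x).
Proof.
case: (boolP dependent) => [dep|indep].
  rewrite (sum_slices _ (s := [:: face_index (level j x)])) // => [|c].
    by rewrite big_seq1 slice_face // face_sign_slice // dep andbF mulr1.
  by rewrite dependent_slice_indices // inE; split=> [/eqP|->].
have [a [N [odd_a sliceP]]] := independent_slice_indices indep.
rewrite (sum_slices _ (s := [seq a + k%:Z | k <- index_iota 0 (2 * N).+1])).
- transitivity (face_sign I (face I x) * \sum_(0 <= k < (2 * N).+1) (-1) ^+ k).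
    rewrite big_map mulr_sumr big_nat [RHS]big_nat; apply: eq_bigr => k kN.
    have [w xw wE] : slice_indices (a + k%:Z) by apply/sliceP; lia.
    rewrite -wE slice_face // face_sign_slice // indep andbT inE.
    rewrite -even_face_index wE -[in RHS]signr_odd.
    by congr (_ * _ ^+ nat_of_bool _); lia.
  by rewrite sumr_sign oddS oddM /= mulr1.
- by rewrite map_inj_uniq ?iota_uniq // => k k' /addrI[].
- move=> c; rewrite sliceP; split=> [/mapP[k]|ac].
    by rewrite mem_index_iota => kN ->; lia.
  by apply/mapP; exists (absz (c - a)); rewrite ?mem_index_iota; lia.
Qed.

End Slices.

Lemma euler_sum_setU1 I S j w : S \subset I -> essential I ->
  euler_sum (j |: I) (face S w) = euler_sum I (face S w).
Proof.
move=> SI essI; have IjI : I \subset j |: I by exact: finset.subsetUr.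
rewrite /euler_sum -[LHS](@sumr_refine _ _ (fset_set (faces I)) _
  (fun F => `[< F `<=` face S w >]) _ (fun G F => `[< G `<=` F >])).
- rewrite big_seq_cond [RHS]big_seq_cond.
  by apply: eq_bigr => F /andP[/facesP[x ->] _]; exact: face_sign_setU1.
- exact: fset_uniq.
move=> _ /facesP[x ->]; exists (face I x); first exact: mem_faces.
split=> [_ /facesP[u ->]|].
  apply/asboolP/eqP => [/(face_subP _ _ IjI)/face_eqP//|->]; exact: faceS.
have SjI := fintype.subset_trans SI IjI; apply: asbool_equiv_eq.
exact: iff_trans (face_subP _ _ SI) (iff_sym (face_subP _ _ SjI)).
Qed.

Lemma euler_sum_subset I J S w : S \subset J -> J \subset I -> essential J ->
  euler_sum I (face S w) = euler_sum J (face S w).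
Proof.
move=> SJ; have [k] := ubnP #|I :\: J|; elim: k I => // k IHk I.
rewrite ltnS => cardI JI essJ; have [->//|neJI] := eqVneq I J.
have [i iI iJ] : exists2 i, i \in I & i \notin J.
  apply/fintype.subsetPn; apply: contraNN neJI => IJ.
  by rewrite finset.eqEsubset IJ.
have JIi : J \subset I :\ i by rewrite subsetD1 JI.
rewrite -(finset.setD1K iI) euler_sum_setU1; last exact: essentialS JIi essJ.
  apply: IHk => //; apply: leq_trans cardI; apply: proper_card.
  rewrite finset.setDDl finset.setUC -finset.setDDl; apply: properD1.
  by rewrite finset.in_setD iJ iI.
exact: fintype.subset_trans SJ JIi.
Qed.

Section FlipWall.
Context (I : {set 'I_m}) (j : 'I_m) (v : 'rV[R]_n).
Hypothesis jI : j \in I.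
Hypothesis v_other : forall i, i \in I :\ j -> form i v = 0.
Hypothesis v_j : form j v = 1.

Definition flip_point x : 'rV[R]_n :=
  slide j v (flip_parity (face_index (level j x))) x.

Definition flip_face F : set (torus R n) :=
  face I (flip_point (xget 0 [set x | F = face I x])).

Lemma level_flip_point i x : i \in I :\ j -> level i (flip_point x) = level i x.
Proof. by move=> /v_other; exact: level_line. Qed.

Lemma face_index_flip_point i x : i \in I ->
  face_index (level i (flip_point x)) =
  if i == j then flip_parity (face_index (level i x))
  else face_index (level i x).
Proof.
move=> iI; case: eqP => [->|/eqP ij]; first exact: face_index_slide.
by rewrite level_flip_point // finset.in_setD1 ij.
Qed.

Lemma flip_face_face x : flip_face (face I x) = face I (flip_point x).
Proof.
rewrite /flip_face; case: xgetP => [u _ /= /esym/face_eqP[z xuz]|/(_ x)];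
  last by case.
apply/face_eqP; exists z => i iI.
rewrite face_index_lattice !face_index_flip_point //.
have := xuz i iI; rewrite face_index_lattice => <-.
by case: ifP => _; rewrite ?flip_parityD.
Qed.

Lemma flip_face_mem : {in fset_set (faces I), forall F,
  flip_face F \in fset_set (faces I)}.
Proof. by move=> _ /facesP[x ->]; rewrite flip_face_face mem_faces. Qed.

Lemma flip_faceK : {in fset_set (faces I), cancel flip_face flip_face}.
Proof.
move=> _ /facesP[x ->]; rewrite !flip_face_face; apply: face_eq_lift => i iI.
rewrite !face_index_flip_point //.
by case: (i == j); rewrite ?flip_parityK.
Qed.

Lemma row_rank_walls_flip x :
  rank (walls x :&: I) = (rank ((walls x :&: I) :\ j) + (j \in walls x))%N.
Proof.
have indep (B : {set 'I_m}) : B \subset I :\ j ->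
    ~~ (row j (map_mx intr A) <= span B)%MS.
  move=> /fintype.subsetP BI; apply/negP => jB.
  have /eqP := row_span_vanish jB (fun i iB => v_other (BI i iB)).
  by rewrite v_j oner_eq0.
case: (boolP (j \in walls x)) => xj.
  rewrite -{1}(finset.setD1K (a := j) (A := walls x :&: I)).
    by rewrite row_rank_setU1 indep // finset.setSD // finset.subsetIr.
  by rewrite finset.in_setI xj.
rewrite addn0; congr (rank _); apply/esym/finset.setDidPl.
by rewrite disjoint_sym disjoints1 finset.in_setI (negPf xj).
Qed.

Lemma face_sign_flip : {in fset_set (faces I), forall F,
  face_sign I (flip_face F) = - face_sign I F}.
Proof.
move=> _ /facesP[x ->]; rewrite flip_face_face !face_signE !row_rank_walls_flip.
have -> : (walls (flip_point x) :&: I) :\ j = (walls x :&: I) :\ j.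
  apply/setP => i; rewrite !finset.in_setD1 !finset.in_setI !inE.
  case: (eqVneq i j) => //= ij.
  case: (boolP (i \in I)) => iI; rewrite ?andbF //.
  by rewrite level_flip_point // finset.in_setD1 ij.
rewrite !inE -!even_face_index face_index_flip_point // eqxx even_flip_parity.
by rewrite !exprD; case: (2 %| _)%Z; rewrite /= ?mulrN1 ?mulr1 ?opprK.
Qed.

Lemma flip_face_sub S w : S \subset I -> j \notin S ->
  {in fset_set (faces I), forall F,
    `[< flip_face F `<=` face S w >] = `[< F `<=` face S w >]}.
Proof.
move=> SI jS; suff sub F : F \in fset_set (faces I) ->
    F `<=` face S w -> flip_face F `<=` face S w.
  move=> F FI; apply/asboolP/asboolP; last exact: sub.
  by rewrite -{2}(flip_faceK FI); apply: sub; exact: flip_face_mem.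
move=> /facesP[x ->]; rewrite flip_face_face => /(face_subP _ _ SI)[z wxz].
apply/(face_subP _ _ SI); exists z => i iS; rewrite -(wxz i iS).
rewrite !face_index_lattice face_index_flip_point;
  last exact: fintype.subsetP iS.
by rewrite ifN //; apply: contraNneq jS => <-.
Qed.

End FlipWall.

(* When the normal of the [j]-th wall is independent of the others, exchanging
   this wall with an adjacent slab is a sign-reversing involution. *)
Lemma euler_sum_independent I S j w : S \subset I -> j \in I -> j \notin S ->
  ~~ (row j (map_mx intr A) <= span (I :\ j))%MS -> euler_sum I (face S w) = 0.
Proof.
move=> SI jI jS /row_span_separate[v [v_other v_j]].
apply: (@sumr_sign_reversing _ _ _ _ _ (flip_face I j v)).
- exact: fset_uniq.
- exact: flip_face_mem.
- exact: flip_faceK.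
- exact: flip_face_sub.
- exact: face_sign_flip.
Qed.

Lemma euler_sum_essential I S w : S \subset walls w -> S \subset I ->
  essential S -> euler_sum I (face S w) = (-1) ^+ n.
Proof.
move=> Sw SI essS; rewrite (euler_sum_subset w (subxx S)) // /euler_sum.
rewrite big_mkcond (bigD1_seq (face S w)) ?mem_faces ?fset_uniq //=.
rewrite big_seq_cond big1 => [|F /andP[/facesP[x ->] /eqP xw]]; last first.
  by case: asboolP => // /(face_subP _ _ (subxx S))/face_eqP.
rewrite addr0 asboolT // face_signE (finset.setIidPr Sw).
by congr (_ ^+ _); exact/eqP.
Qed.

Lemma euler_sum_not_essential I S w : S \subset I -> essential I ->
  ~~ essential S -> euler_sum I (face S w) = 0.
Proof.
move=> SI essI nessS.
have [J /minsetP[/andP[SJ essJ] minJ] JI] :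
    {J | minset (fun J => (S \subset J) && essential J) J & J \subset I}.
  by apply: minset_exists; rewrite SI.
rewrite (euler_sum_subset w SJ JI essJ).
have [j jJ jS] : exists2 j, j \in J & j \notin S.
  apply/fintype.subsetPn; apply: contraNN nessS => JS.
  by have -> : S = J by apply/eqP; rewrite finset.eqEsubset SJ.
apply: (@euler_sum_independent J S j) => //; apply: essential_row_setD1 => //.
apply/negP => essJj; have := finset.subsetDl J [set j]%SET.
move/(minJ (J :\ j)); rewrite subsetD1 SJ jS essJj => /(_ isT) JjJ.
by move: jJ; rewrite -JjJ setD11.
Qed.

(** * Regions and flats as faces *)

Lemma bigcap_wall S x : S \subset walls x ->
  \bigcap_(i in [set` S]) wall i = stratum S x.
Proof.
move=> Sx; apply/seteqP; split=> p; have [w <-] := torus_proj_surj p.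
  move=> Sw; apply/stratum_proj; rewrite (finset.setIidPr Sx).
  by apply/finset.setIidPr/fintype.subsetP => i iS; apply/wall_proj/Sw.
move=> /stratum_proj; rewrite (finset.setIidPr Sx) => wS i /= iS.
by apply/wall_proj; move: iS; rewrite -{1}wS finset.in_setI => /andP[].
Qed.

Lemma flatsP Y : flats wall Y <->
  Y = set0 \/ exists S x, S \subset walls x /\ Y = face S x.
Proof.
split=> [[->|[S [p Sp ->]]]|[->|[S [x [Sx ->]]]]]; [by left| |by left|].
  have [x xp] := torus_proj_surj p; subst p; right; exists S, x.
  have Sx : S \subset walls x.
    by apply/fintype.subsetP => i iS; apply/wall_proj/Sp.
  by rewrite (bigcap_wall Sx) connected_component_stratum.
right; exists S, (proj x).
  by move=> i /= iS; apply/wall_proj/(fintype.subsetP Sx).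
by rewrite (bigcap_wall Sx) connected_component_stratum.
Qed.

Lemma complement_walls x : walls x = finset.set0 ->
  ~` (\bigcup_i wall i) = stratum [set: 'I_m]%SET x.
Proof.
move=> x0; apply/seteqP; split=> p; have [w <-] := torus_proj_surj p.
  move=> nw; apply/stratum_proj; rewrite x0 finset.set0I finset.setIT.
  apply/setP => i; rewrite finset.in_set0; apply/negP => /wall_proj wi.
  by apply: nw; exists i.
move=> /stratum_proj; rewrite x0 finset.set0I finset.setIT => w0.
by move=> [i _ /wall_proj]; rewrite w0 finset.in_set0.
Qed.

Lemma regionsP F : regions wall F <->
  exists x, walls x = finset.set0 /\ F = face [set: 'I_m]%SET x.
Proof.
split=> [[p np ->]|[x [x0 ->]]].
  have [x xp] := torus_proj_surj p; subst p.
  have x0 : walls x = finset.set0.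
    apply/setP => i; rewrite finset.in_set0; apply/negP => /wall_proj xi.
    by apply: np; exists i.
  by exists x; rewrite (complement_walls x0) connected_component_stratum.
rewrite /regions /= (complement_walls x0) -connected_component_stratum.
by exists (proj x) => //; apply/stratum_proj.
Qed.

Lemma finite_regions : finite_set (regions wall).
Proof.
apply: sub_finite_set (finite_faces [set: 'I_m]%SET).
by move=> F /regionsP[x [_ ->]]; exists x.
Qed.

Lemma finite_flats : finite_set (flats wall).
Proof.
apply: (@sub_finite_set _ _
  ([set set0] `|` \bigcup_(S in [set: {set 'I_m}]) faces S)).
  move=> Y /flatsP[->|[S [x [_ ->]]]]; first by left.
  by right; exists S => //; exists x.
rewrite finite_setU; split; first exact: finite_set1.
by apply: bigcup_finite => [|S _]; [exact: finite_finset|exact: finite_faces].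
Qed.

Local Notation P := (intersection_poset wall).

Lemma mem_poset Y : (Y \in P) = `[< flats wall Y >].
Proof.
rewrite /intersection_poset in_fset_set; last exact: finite_flats.
by apply/idP/asboolP; rewrite inE.
Qed.

Lemma face_poset S x : S \subset walls x -> face S x \in P.
Proof.
by move=> Sx; rewrite mem_poset; apply/asboolP/flatsP; right; exists S, x.
Qed.

Lemma set0_poset : set0 \in P.
Proof. by rewrite mem_poset; apply/asboolP; left. Qed.

(** * Möbius inversion over the flats *)

Lemma flat_sub_face Y x : flats wall Y ->
  face [set: 'I_m]%SET x `<=` Y <-> face (walls x) x `<=` Y.
Proof.
move=> flatY; split=> [xY|]; last first.
  by apply: subset_trans; apply: faceS; exact: finset.subsetT.
have Yx := xY _ (face_refl _ x).
case/flatsP: flatY => [Y0|[S [w [Sw YE]]]]; first by rewrite Y0 in Yx.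
rewrite YE in Yx *; rewrite -(face_eq Yx); apply: faceS.
have /face_projP[z wxz] := Yx; apply/fintype.subsetP => i iS.
rewrite -(walls_lattice x z) (face_lift_walls wxz iS).
exact: fintype.subsetP iS.
Qed.

Hypothesis primitive : primitive_rows A.

Lemma face_eqT S x : S \subset walls x ->
  (face S x == setT) = (S == finset.set0).
Proof.
move=> Sx; have [->|/finset.set0Pn[i iS]] := eqVneq S finset.set0.
  by rewrite face_set0 eqxx.
apply/eqP => xT; have [z iz] := primitive i.
have : face S x (proj (x + 2^-1 *: lattice_vec z)) by rewrite xT.
move=> /face_projP[z' /face_lift_walls/(_ iS)].
rewrite (fintype.subsetP Sx) // walls_lattice inE levelD row_formZ row_form_map.
have := fintype.subsetP Sx i iS; rewrite iz mulr1 inE => xi.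
by rewrite rpredDl // (negPf half_not_int).
Qed.

Lemma sum_mobius_face x :
  \sum_(Y <- P | `[< face [set: 'I_m]%SET x `<=` Y >]) mobius P setT Y =
  (walls x == finset.set0)%:Z.
Proof.
rewrite -(face_eqT (subxx (walls x))) -(sum_mobius_setT (face_poset (subxx _))).
rewrite big_seq_cond [RHS]big_seq_cond; apply: eq_bigl => Y.
case: (boolP (Y \in P)) => //=; rewrite mem_poset => /asboolP flatY.
by apply/asboolP/asboolP => /(flat_sub_face _ flatY).
Qed.

Lemma face_sign_mobius x :
  (face [set: 'I_m]%SET x \in fset_set (regions wall))%:Z =
  face_sign [set: 'I_m]%SET (face [set: 'I_m]%SET x) *
  \sum_(Y <- P | `[< face [set: 'I_m]%SET x `<=` Y >]) mobius P setT Y.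
Proof.
rewrite sum_mobius_face face_signE in_fset_set; last exact: finite_regions.
have [x0|xn0] := eqVneq (walls x) finset.set0.
  rewrite x0 finset.set0I row_rank0 expr0 mulr1.
  by rewrite mem_set //; apply/regionsP; exists x.
rewrite mulr0 memNset // => /regionsP[w [w0 /face_eqP[z wxz]]].
have := face_lift_wallsI wxz; rewrite walls_lattice !finset.setIT w0.
by move=> x0; rewrite x0 eqxx in xn0.
Qed.

Lemma card_regions_euler_sum :
  #|` fset_set (regions wall)|%:Z =
  \sum_(Y <- P) mobius P setT Y * euler_sum [set: 'I_m]%SET Y.
Proof.
set T := [set: 'I_m]%SET.
rewrite (card_fset_indicator (Q := fset_set (faces T))); last first.
  rewrite -fset_set_sub; [|exact: finite_regions|exact: finite_faces].
  by move=> F /regionsP[x [_ ->]]; exists x.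
transitivity (\sum_(F <- fset_set (faces T)) face_sign T F *
    \sum_(Y <- P | `[< F `<=` Y >]) mobius P setT Y).
  rewrite big_seq [RHS]big_seq; apply: eq_bigr => _ /facesP[x ->].
  exact: face_sign_mobius.
under eq_bigr do rewrite mulr_sumr big_mkcond.
rewrite exchange_big; apply: eq_bigr => Y _.
rewrite mulr_sumr [RHS]big_mkcond; apply: eq_bigr => F _.
by case: ifP => // _; rewrite mulrC.
Qed.

(** * Coatoms *)

Lemma essential_face S x : S \subset walls x -> essential S ->
  face S x = [set proj x].
Proof.
move=> Sx essS; apply/seteqP; split=> [_ [w xw <-] /=|_ ->];
  last exact: face_refl.
congr proj; apply/eqP; rewrite -subr_eq0; apply/eqP.
apply: (essential_inj essS) => i iS; rewrite -levelB.
rewrite (face_lift_level xw) ?subrr // finset.in_setI iS.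
by rewrite (fintype.subsetP Sx).
Qed.

Hypothesis essT : essential [set: 'I_m]%SET.

Lemma not_essential_face S x : S \subset walls x -> ~~ essential S ->
  exists2 Y, Y \in P & [/\ Y != set0, Y `<=` face S x & face S x != Y].
Proof.
move=> Sx nessS; have [j] := essential_exists_row essT nessS.
move=> /row_span_separate[v [vS vj]]; pose y c := slide j v c x.
have xy c : face_lift S x (y c) by move=> i iS; rewrite level_line // vS.
have Sy : j |: S \subset walls (y 0).
  apply/fintype.subsetP => i /setU1P[->|iS].
    by rewrite inE -even_face_index face_index_slide.
  by rewrite (face_lift_walls (xy 0) iS); exact: fintype.subsetP iS.
exists (face (j |: S) (y 0)); first exact: face_poset.
split; first exact: face_neq0.
  by rewrite -(face_eq_lift (xy 0)); apply: faceS; exact: finset.subsetUr.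
apply/eqP => xE; have : face (j |: S) (y 0) (proj (y 1)).
  by rewrite -xE -(face_eq_lift (xy 1)); exact: face_refl.
move=> /face_projP[z /face_lift_walls/(_ (setU11 j S))].
by rewrite walls_lattice !inE -!even_face_index !face_index_slide.
Qed.

Lemma coatom_essential S x : S \subset walls x ->
  covered_in P (face S x) set0 = essential S.
Proof.
move=> Sx; apply/idP/idP => [|essS]; last first.
  have := face_poset Sx; rewrite essential_face // => xP.
  exact: covered_in_set1 xP set0_poset.
apply: contraLR => /(not_essential_face Sx)[Y YP [Y0 Yx xY]].
exact: not_covered_in_set0 Y0 Yx xY.
Qed.

Lemma card_regions : #|` fset_set (regions wall)|%:Z = Zt wall.
Proof.
rewrite card_regions_euler_sum /Zt [RHS]big_mkcond big_seq [RHS]big_seq.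
apply: eq_bigr => Y; rewrite mem_poset => /asboolP/flatsP[->|[S [x [Sx ->]]]].
  rewrite /covered_in ltxx !andbF /euler_sum big_seq_cond big1 ?mulr0 //.
  move=> F /andP[/facesP[x ->] /asboolP x0].
  by have := x0 _ (face_refl _ x).
rewrite coatom_essential //; case: ifPn => essS.
  rewrite (euler_sum_essential Sx) ?finset.subsetT // essential_face //.
  by rewrite toric_rank_set1 mulrC.
by rewrite euler_sum_not_essential ?finset.subsetT // mulr0.
Qed.

End Arrangement.

(** * Loops in an open cell are contractible *)

Section CenteredFrac.
Context {R : realType}.
Implicit Types r e : R.

Definition centered_frac r : R := r - (Num.floor (r + 2^-1))%:~R.

Lemma centered_fracDz r (c : int) : centered_frac (r + c%:~R) = centered_frac r.
Proof.
rewrite /centered_frac [X in Num.floor X]addrAC floorDrz ?intr_int //.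
by rewrite intrKfloor intrD opprD addrACA subrr addr0.
Qed.

Lemma centered_frac_small r : `|r| < 2^-1 -> centered_frac r = r.
Proof.
rewrite ltr_norml /centered_frac => /andP[lo hi].
by rewrite (_ : Num.floor _ = 0) ?subr0 //; apply: floor_def; lra.
Qed.

Lemma centered_frac_eq0 r : centered_frac r = 0 -> r \is a Num.int.
Proof. by move=> /subr0_eq ->; exact: intr_int. Qed.

Lemma centered_frac_ltP r e : e <= 2^-1 ->
  `|centered_frac r| < e <-> exists c : int, `|r - c%:~R| < e.
Proof.
move=> e2; split=> [re|[c rce]]; first by exists (Num.floor (r + 2^-1)).
rewrite -[r](subrK c%:~R) centered_fracDz centered_frac_small //.
exact: lt_le_trans rce e2.
Qed.

Lemma open_centered_frac e : e <= 2^-1 -> open [set r | `|centered_frac r| < e].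
Proof.
move=> e2; rewrite (_ : [set r | _] =
    \bigcup_(c in [set: int]) ball (c%:~R : R) e).
  by apply: bigcup_open => c _; exact: ball_open.
apply/seteqP; split=> r /=.
  move=> /(centered_frac_ltP _ e2)[c rc]; exists c => //.
  by rewrite -ball_normE /= distrC.
move=> [c _]; rewrite -ball_normE /= distrC => rc.
by apply/(centered_frac_ltP _ e2); exists c.
Qed.

End CenteredFrac.

Section Displacement.
Context {R : realType} {n : nat} (k : 'I_n).
Implicit Types (p q : torus R n) (x w : 'rV[R]_n).

Local Notation proj := (@torus_proj R n).

(* The representative of least absolute value of the difference of the [k]-th
   coordinates, which are only defined modulo [1]. *)
Definition displacement p q : R :=
  centered_frac ((repr p : 'rV[R]_n) ord0 k - (repr q : 'rV[R]_n) ord0 k).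

Lemma displacement_proj x w :
  displacement (proj x) (proj w) = centered_frac (x ord0 k - w ord0 k).
Proof.
rewrite /displacement.
have [z ->] := (torus_proj_eq _ _).1 (esym (torus_proj_repr (proj x))).
have [z' ->] := (torus_proj_eq _ _).1 (esym (torus_proj_repr (proj w))).
rewrite -[RHS](centered_fracDz _ (z ord0 k - z' ord0 k)) !mxE intrB.
by congr centered_frac; ring.
Qed.

Lemma displacement_refl p : displacement p p = 0.
Proof. by rewrite /displacement subrr centered_frac_small // normr0; lra. Qed.

Lemma displacement_near p : \forall q \near p, `|displacement q p| < 8^-1.
Proof.
apply: open_nbhs_nbhs; split; last by rewrite /= displacement_refl normr0; lra.
rewrite /open/= /quotient_open; have [x <-] := torus_proj_surj p.
rewrite (_ : _ @^-1` _ = (fun w : 'rV[R]_n => w ord0 k - x ord0 k)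
    @^-1` [set r | `|centered_frac r| < 8^-1]); last first.
  by apply/seteqP; split=> w /=; rewrite (displacement_proj w x).
apply: open_comp; last by apply: open_centered_frac; lra.
move=> w _; apply: (@cvgB _ _ _ (nbhs (w : 'rV[R]_n))); last exact: cvg_cst.
exact: coord_continuous.
Qed.

Lemma displacement_near_diagonal p :
  \forall q \near p & q' \near p, `|displacement q' q| < 4^-1.
Proof.
have le2 : 8^-1 <= 2^-1 :> R by lra.
pose V := [set q | `|displacement q p| < 8^-1].
exists (V, V); first by split; exact: displacement_near.
move=> [q q'] /= [/(centered_frac_ltP _ le2)[c qc]].
move=> /(centered_frac_ltP _ le2)[c' qc'].
apply/centered_frac_ltP; first by lra.
exists (c' - c); rewrite intrB; move: qc qc'; rewrite !ltr_norml.
by move=> /andP[? ?] /andP[? ?]; apply/andP; split; lra.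
Qed.

(* The sum around the square is an integer of absolute value less than 1. *)
Lemma displacement_square p q p' q' :
  `|displacement q p| < 4^-1 -> `|displacement q' q| < 4^-1 ->
  `|displacement p' p| < 4^-1 -> `|displacement q' p'| < 4^-1 ->
  displacement q p + displacement q' q = displacement p' p + displacement q' p'.
Proof.
rewrite !ltr_norml => /andP[? ?] /andP[? ?] /andP[? ?] /andP[? ?].
apply/eqP; rewrite -subr_eq0; set d := (X in X == 0).
have dint : d \is a Num.int.
  rewrite /d /displacement /centered_frac; set c1 := Num.floor _.
  set c2 := Num.floor _; set c3 := Num.floor _; set c4 := Num.floor _.
  rewrite [X in X \is a _](_ : _ = (c3 + c4 - c1 - c2)%:~R) ?intr_int //.
  by rewrite !(intrD, intrN); ring.
apply: contraT => /(norm_intr_ge1 dint); apply: contra_leT => _.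
by rewrite ltr_norml /d; lra.
Qed.

Definition unit_square : set (R * R) := `[0, 1] `*` `[0, 1].

Definition fine_mesh (N : nat) (G : R * R -> torus R n) : Prop :=
  forall u u', unit_square u ->
    `|u.1 - u'.1| <= N.+1%:R^-1 -> `|u.2 - u'.2| <= N.+1%:R^-1 ->
    `|displacement (G u') (G u)| < 4^-1.

Lemma near_fine_mesh (G : R * R -> torus R n) :
  (forall u, unit_square u -> {for u, continuous G}) ->
  \forall N \near \oo, fine_mesh N G.
Proof.
move=> Gcont; have square_compact : compact unit_square.
  by apply: compact_setX; exact: segment_compact.
have small_diagonal u : unit_square u -> \forall u' \near u & u'' \near u,
    `|displacement (G u'') (G u')| < 4^-1.
  move=> /Gcont Gu.
  have [[U V] [/= nU nV] UV] := displacement_near_diagonal (G u).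
  exists (G @^-1` U, G @^-1` V); first by split; exact: Gu.
  by move=> [u' u''] [/= Uu' Vu'']; exact: (UV (G u', G u'')).
have [e [ball_small e0]] := @filter_ex _ (0 : R)^'+ _ _ (filterI
  (compact_near_diagonal square_compact small_diagonal) (nbhs_right_gt 0)).
near=> N => u u' Ku u1 u2; apply: ball_small => //.
have Ne : N.+1%:R^-1 < e by near: N; exact: near_infty_natSinv_lt (PosNum e0).
by split; rewrite -ball_normE /=; apply: le_lt_trans Ne.
Unshelve. all: by end_near. Qed.

Definition mesh_point (N i : nat) : R := i%:R / N.+1%:R.

Lemma mesh_point_in N i : (i <= N.+1)%N -> 0 <= mesh_point N i <= 1.
Proof. by move=> iN; rewrite divr_ge0 //= ler_pdivrMr // mul1r ler_nat. Qed.

Lemma mesh_pointS N i : mesh_point N i.+1 = mesh_point N i + N.+1%:R^-1.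
Proof. by rewrite /mesh_point -natr1 mulrDl mul1r. Qed.

Lemma mesh_point0 N : mesh_point N 0 = 0.
Proof. exact: mul0r. Qed.

Lemma mesh_point_last N : mesh_point N N.+1 = 1.
Proof. by rewrite /mesh_point divff. Qed.

Definition winding (N : nat) (gamma : R -> torus R n) : R :=
  \sum_(0 <= j < N.+1)
    displacement (gamma (mesh_point N j.+1)) (gamma (mesh_point N j)).

Lemma winding_homotopy (N : nat) (G : R * R -> torus R n) : fine_mesh N G ->
  (forall s, 0 <= s <= 1 -> G (s, 0) = G (s, 1)) ->
  winding N (fun t => G (0, t)) = winding N (fun t => G (1, t)).
Proof.
move=> fineG closedG; rewrite -(mesh_point0 N) -{1}(mesh_point_last N).
pose node i j := G (mesh_point N i, mesh_point N j).
have in_square i j : (i <= N.+1)%N -> (j <= N.+1)%N ->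
    unit_square (mesh_point N i, mesh_point N j).
  by move=> /mesh_point_in iN /mesh_point_in jN; split; rewrite /= in_itv.
have stay (s : R) : `|s - s| <= N.+1%:R^-1 by rewrite subrr normr0.
have next i : `|mesh_point N i - mesh_point N i.+1| <= N.+1%:R^-1.
  by rewrite mesh_pointS opprD addNKr normrN ger0_norm.
have small_h i j : (i <= N.+1)%N -> (j <= N)%N ->
    `|displacement (node i j.+1) (node i j)| < 4^-1.
  move=> iN jN; apply: fineG; [|exact: stay|exact: next].
  by apply: in_square => //; exact: leqW.
have small_v i j : (i <= N)%N -> (j <= N.+1)%N ->
    `|displacement (node i.+1 j) (node i j)| < 4^-1.
  move=> iN jN; apply: fineG; [|exact: next|exact: stay].
  by apply: in_square => //; exact: leqW.
apply: (sum_grid_rows (M := N.+1)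
  (h := fun i j => displacement (node i j.+1) (node i j))
  (v := fun i j => displacement (node i.+1 j) (node i j))) => [i j iN jN|i iN].
  apply: displacement_square; [exact: small_h (ltnW iN) jN|exact: small_v|
    exact: small_v iN (ltnW jN)|exact: small_h].
by rewrite /node mesh_point0 mesh_point_last !closedG // mesh_point_in // ltnW.
Qed.

Lemma winding_const N (gamma : R -> torus R n) p :
  (forall t, 0 <= t <= 1 -> gamma t = p) -> winding N gamma = 0.
Proof.
move=> gammaE; rewrite /winding big_nat big1 // => j /andP[_ jN].
by rewrite !gammaE ?displacement_refl // mesh_point_in // ltnW.
Qed.

Lemma winding_line N (gamma : R -> torus R n) x (v : 'rV[int]_n) :
  (forall t, 0 <= t <= 1 -> gamma t = proj (x + t *: lattice_vec v)) ->
  winding N gamma = N.+1%:R * centered_frac ((v ord0 k)%:~R / N.+1%:R).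
Proof.
move=> gammaE; transitivity (\sum_(0 <= j < N.+1)
    centered_frac ((v ord0 k)%:~R / N.+1%:R : R)); last first.
  by rewrite sumr_const_nat subn0 mulr_natl.
apply: eq_big_nat => j /andP[_ jN].
rewrite !gammaE ?mesh_point_in // 1?ltnW // displacement_proj !mxE mesh_pointS.
by congr centered_frac; ring.
Qed.

End Displacement.

Lemma null_homotopic_line {R : realType} {n : nat} (G : R * R -> torus R n)
    (p : torus R n) (x : 'rV[R]_n) (v : 'rV[int]_n) :
  (forall u, unit_square u -> {for u, continuous G}) ->
  (forall s, 0 <= s <= 1 -> G (s, 0) = G (s, 1)) ->
  (forall t, 0 <= t <= 1 -> G (0, t) = torus_proj (x + t *: lattice_vec v)) ->
  (forall t, 0 <= t <= 1 -> G (1, t) = p) ->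
  v = 0.
Proof.
move=> Gcont closedG G0 G1; apply/rowP => k; rewrite mxE.
have [N [fineG /= vN]] := @filter_ex _ \oo _ _
  (filterI (near_fine_mesh k Gcont) (nbhs_infty_ge (absz (v ord0 k)))).
have /eqP := winding_homotopy fineG closedG.
rewrite (winding_line k N G0) (winding_const k N G1) mulf_eq0 pnatr_eq0 /=.
move=> /eqP/centered_frac_eq0/norm_intr_ge1.
apply: contraPeq => v0.
rewrite mulf_neq0 ?invr_eq0 ?pnatr_eq0 ?intr_eq0 // => /(_ isT).
rewrite normrM normfV normr_nat ler_pdivlMr // mul1r -intr_norm -abszE ler_nat.
by rewrite leqNgt ltnS vN.
Qed.

Section OpenUnitBall.
Context {R : realType} {n : nat}.
Implicit Types x w : 'rV[R]_n.

Lemma open_open_unit_ball : open (@open_unit_ball R n).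
Proof.
apply: (@open_comp _ _ (fun x : 'rV[R]_n => \sum_i x ord0 i ^+ 2)
  [set r | r < 1]).
  move=> x _; apply: continuous_big => [|i _ y]; first exact: add_continuous.
  by apply: (@cvgM _ _ (nbhs (y : 'rV[R]_n))); exact: coord_continuous.
exact: open_lt.
Qed.

Lemma open_unit_ball_convex x w (s : R) : open_unit_ball x ->
  open_unit_ball w -> 0 <= s <= 1 -> open_unit_ball (x + s *: (w - x)).
Proof.
rewrite /open_unit_ball /= => x1 w1 /andP[s0 s1].
apply: (@le_lt_trans _ _
  (\sum_i ((1 - s) * x ord0 i ^+ 2 + s * w ord0 i ^+ 2))).
  apply: ler_sum => i _; rewrite !mxE -subr_ge0.
  have -> : (1 - s) * x ord0 i ^+ 2 + s * w ord0 i ^+ 2 -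
    (x ord0 i + s * (w ord0 i - x ord0 i)) ^+ 2 =
    s * (1 - s) * (x ord0 i - w ord0 i) ^+ 2 by ring.
  by rewrite mulr_ge0 ?sqr_ge0 // mulr_ge0 // subr_ge0.
rewrite big_split /= -!mulr_sumr; set a := \sum_i _ in x1 *.
set c := \sum_i _ in w1 *; apply: (@le_lt_trans _ _ (Num.max a c)).
  have aM : a <= Num.max a c by rewrite le_max lexx.
  have cM : c <= Num.max a c by rewrite le_max lexx orbT.
  by nra.
by rewrite gt_max x1 w1.
Qed.

End OpenUnitBall.

Lemma open_cell_no_loop {R : realType} {n : nat} (X : set (torus R n))
    (x : 'rV[R]_n) (v : 'rV[int]_n) :
  open_cell X -> (forall t : R, X (torus_proj (x + t *: lattice_vec v))) ->
  v = 0.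
Proof.
move=> [f [g [fcont gcont fX _ [fK _]]]] lineX.
pose loop (t : R) := torus_proj (x + t *: lattice_vec v).
pose floop (t : R) : 'rV[R]_n := f (loop t).
have floop_ball t : open_unit_ball (floop t) by apply/fX/imageP/lineX.
have floop_cont : continuous floop.
  move=> t U /((subspace_continuousP X f).1 fcont _ (lineX t)).
  move=> /torus_line_continuous near_t.
  apply: (@filterS _ (nbhs (t : R)) _ _ _ _ near_t) => s /= Us.
  by apply: Us; exact: lineX.
have loop1 : loop 1 = loop 0.
  by rewrite /loop scale1r scale0r addr0 torus_proj_lattice.
have gfloop t : g (floop t) = loop t by rewrite /floop fK // inE; exact: lineX.
pose contract (u : R * R) := floop u.2 + u.1 *: (floop 0 - floop u.2).
apply: (@null_homotopic_line R n (g \o contract) (loop 0) x v).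
- move=> [s t] [/= s01 t01]; rewrite in_itv /= in s01.
  apply: continuous_comp; last first.
    have := gcont; rewrite (continuous_open_subspace _ open_open_unit_ball).
    by apply; rewrite inE; exact: open_unit_ball_convex.
  have floop2 : floop u.2 @[u --> (s, t)] --> floop t.
    apply: (@cvg_comp _ _ _ snd floop _ (nbhs t)); first exact: cvg_snd.
    exact: floop_cont.
  apply: cvgD => //; apply: cvgZ; first exact: cvg_fst.
  by apply: cvgB => //; exact: cvg_cst.
- by move=> s _; rewrite /contract /= /floop loop1.
- by move=> t _; rewrite /contract /= scale0r addr0 gfloop.
- by move=> t _; rewrite /contract /= scale1r addrC subrK gfloop.
Qed.

(** * Cellular arrangements are essential *)

Section Essential.
Context {R : realType} {n m : nat} (A : 'M[int]_(m, n)) (b : 'I_m -> R).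
Hypothesis primitive : primitive_rows A.

Lemma exists_off_walls : exists x, walls A b x = finset.set0.
Proof.
suff descent k x :
    (#|walls A b x| < k)%N -> exists x, walls A b x = finset.set0.
  exact: (descent _ 0 (ltnSn _)).
elim: k x => // k IHk x; rewrite ltnS => xk.
have [|/finset.set0Pn[i xi]] := eqVneq (walls A b x) finset.set0.
  by exists x.
have [z iz] := primitive i.
have [e e0 star_e] := open_star_line A b [set: 'I_m]%SET x (lattice_vec z).
have {}star_e j :
    face_star (level A b j x) (level A b j (x + e *: lattice_vec z)).
  by apply: star_e; rewrite ?finset.in_setT // gtr0_norm.
apply: (IHk (x + e *: lattice_vec z)); apply: leq_trans xk; apply: proper_card.
apply/fintype.properP; split.
  apply/fintype.subsetP => j; apply: contraLR; rewrite !inE => xj.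
  rewrite -even_face_index (face_index_star_nonint xj (star_e j)).
  by rewrite even_face_index.
exists i => //; move: xi; rewrite !inE => xi.
rewrite -even_face_index (face_index_star_gt xi (star_e i)); last first.
  by rewrite levelD row_formZ row_form_map iz mulr1 ltrDl.
by move: xi; rewrite -even_face_index; lia.
Qed.

Lemma open_cells_essential :
  (forall X, regions (wall A b) X -> open_cell X) ->
  essential (map_mx intr A : 'M[R]_(m, n)) [set: 'I_m]%SET.
Proof.
move=> cells; apply: contrapT => /negP/not_essential_int_kernel[v v0 Av].
have [x x0] := exists_off_walls; case/eqP: v0.
apply: (@open_cell_no_loop R n (face A b [set: 'I_m]%SET x) x).
  by apply: cells; apply/regionsP; exists x.
move=> t; exists (x + t *: lattice_vec v) => // i _.
by rewrite level_line // row_form_map Av.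
Qed.

End Essential.

(** * Normal form of a toric arrangement *)

Lemma torus_proj_level_set (R : realType) n (l z : 'rV[int]_n) (b : R) :
  row_form l ord0 z = 1 ->
  @torus_proj R n @` [set x | row_form (map_mx intr l) ord0 x = b] =
  @torus_proj R n @`
    [set x | row_form (map_mx intr l) ord0 x - b \is a Num.int].
Proof.
move=> lz; apply/seteqP; split=> _ [x /= xb <-].
  by exists x => //=; rewrite xb subrr rpred0.
exists (x - lattice_vec (Num.floor (row_form (map_mx intr l) ord0 x - b) *: z)).
  by rewrite /= row_formB row_form_map row_formZ lz mulr1 /= floorK //; ring.
by rewrite -lattice_vecN torus_proj_lattice.
Qed.

Lemma toric_hyperplane_normal (R : realType) n (X : set (torus R n)) :
  toric_hyperplane X -> exists (l z : 'rV[int]_n) (b : R),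
    row_form l ord0 z = 1 /\
    X = @torus_proj R n @`
      [set x | row_form (map_mx intr l) ord0 x - b \is a Num.int].
Proof.
move=> [a [b0 [a0 ->]]]; have [c [l [z [c0 aE lz]]]] := rat_row_primitive a0.
have c0R : ratr c != 0 :> R by rewrite fmorph_eq0.
exists l, z, (b0 / ratr c); split=> //; rewrite -(torus_proj_level_set _ lz).
congr (_ @` _); apply/funext => x; apply/propext => /=.
have -> : \sum_i ratr (a ord0 i) * x ord0 i =
    ratr c * row_form (map_mx intr l) ord0 x.
  rewrite row_formE mulr_sumr; apply: eq_bigr => i _.
  by rewrite aE !mxE rmorphM /= ratr_int mulrA.
by split=> [<-|->]; [rewrite mulrC mulKf|rewrite mulrC divfK].
Qed.

Lemma toric_arrangement_normal (R : realType) n m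
    (H : 'I_m -> set (torus R n)) :
  (forall i, toric_hyperplane (H i)) ->
  exists (A : 'M[int]_(m, n)) (b : 'I_m -> R),
    primitive_rows A /\ H = wall A b.
Proof.
move=> hyperplaneH.
have [l /choice[z /choice[b Hlzb]]] :=
  choice (fun i => toric_hyperplane_normal (hyperplaneH i)).
exists (\matrix_i l i), b; split=> [i|].
  exists (z i); have [<- _] := Hlzb i.
  by rewrite !row_formE; apply: eq_bigr => j _; rewrite mxE.
apply/funext => i; have [_ ->] := Hlzb i; congr (_ @` _).
apply/funext => x /=; congr (is_true (_ - _ \is a Num.int)).
by rewrite !row_formE; apply: eq_bigr => j _; rewrite !mxE.
Qed.

Theorem theorem3p11 (R : realType) (n m : nat) (H : 'I_m -> set (torus R n))
  (H_hyperplane : forall i, toric_hyperplane (H i))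
  (H_cells : forall X : set (torus R n), regions H X -> open_cell X) :
  finite_set (regions H) /\ (#|` fset_set (regions H) |)%:Z = Zt H.
Proof.
have [A [b [primitive HE]]] := toric_arrangement_normal H_hyperplane; subst H.
have essT := open_cells_essential primitive H_cells.
by split; [exact: finite_regions|exact: card_regions].
Qed.
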